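(* For $d\ge3$ let $\mathcal{A}_{\mathbb{Z}^d}=\{K\subset\mathbb{Z}^d: K\text{ finite},\ K\ne\emptyset,\ \mathrm{cap}(K)\le\frac{2}{g(0)}\}$. Then $$\mathcal{A}_{\mathbb{Z}^d}=\{K\subset\mathbb{Z}^d: 1\le|K|\le2\}\quad\text{for all }d\ge4,$$ and $$\mathcal{A}_{\mathbb{Z}^3}=\{K\subset\mathbb{Z}^3: 1\le|K|\le2,\ \text{ or }|K|=3\text{ and }K\text{ is connected}\}.$$
   Context: $P_x$ is the law of discrete-time simple random walk $(X_n)$ on $\mathbb{Z}^d$ started at $x$; $g(0)=\sum_{n\ge0}P_0(X_n=0)$. For finite $K\subset\mathbb{Z}^d$, $\mathrm{cap}(K)=\sum_{x\in K}P_x(\widetilde{H}_K=\infty)$ with $\widetilde{H}_K=\inf\{n\ge1:X_n\in K\}$. Connectedness is with respect to the nearest-neighbor graph on $\mathbb{Z}^d$. *)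

(* Defs.v *)
From HB Require Import structures.
From mathcomp Require Import all_boot all_order all_algebra.
From mathcomp Require Import finmap.
From mathcomp Require Import all_classical all_reals all_analysis.

Set Implicit Arguments.
Unset Strict Implicit.
Unset Printing Implicit Defensive.

Import Order.TTheory GRing.Theory Num.Theory.

Local Open Scope classical_set_scope.
Local Open Scope fset_scope.
Local Open Scope ring_scope.

Definition lattice_adj (d : nat) : rel 'rV[int]_d :=
  fun x y => \sum_(i < d) `|x 0 i - y 0 i| == 1.

Definition lattice_connected (d : nat) (K : {fset 'rV[int]_d}) : Prop :=
  forall x y, x \in K -> y \in K ->
    exists p : seq 'rV[int]_d,
      [/\ path (@lattice_adj d) x p, {subset p <= K} & last x p = y].

Definition srw_step (R : realType) (d : nat) (x y : 'rV[int]_d) : R :=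
  if lattice_adj x y then (2 * d%:R)^-1 else 0.

(* [(X n)] is simple random walk started at [x] under [P x]: it is a process
   with values in the discrete space Z^d, and its finite-dimensional
   distributions are
   P_x(X_0 = z_0, ..., X_n = z_n) = 1{z_0 = x} \prod_(k < n) p(z_k, z_(k+1)),
   which determines the law of [(X n)] under [P x]. *)
Definition simple_random_walk (R : realType) (d : nat)
    (disp : measure_display) (Omega : measurableType disp)
    (P : 'rV[int]_d -> probability Omega R)
    (X : nat -> Omega -> 'rV[int]_d) : Prop :=
  (forall n z, measurable (X n @^-1` [set z])) /\
  (forall x n (z : nat -> 'rV[int]_d),
    P x [set w | forall k, (k <= n)%N -> X k w = z k] =
      ((z 0%N == x)%:R * \prod_(k < n) srw_step R (z k) (z k.+1))%:E).

Section Capacity.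
Local Open Scope ereal_scope.
Context (R : realType) (d : nat).
Context (disp : measure_display) (Omega : measurableType disp).
Variables (P : 'rV[int]_d -> probability Omega R).
Variables (X : nat -> Omega -> 'rV[int]_d).

Definition green0 : \bar R := \sum_(0 <= n <oo) P 0%R [set w | X n w = 0%R].

(* inf{n >= 1 : X_n \in K}; the infimum of the empty set is +oo. *)
Definition hitting_time (K : {fset 'rV[int]_d}) (w : Omega) : \bar R :=
  ereal_inf [set n%:R%:E | n in [set n | (1 <= n)%N /\ X n w \in K]].

Definition capacity (K : {fset 'rV[int]_d}) : \bar R :=
  \sum_(x <- K) P x [set w | hitting_time K w = +oo].

Definition small_capacity_sets : set {fset 'rV[int]_d} :=
  [set K | K != fset0 /\ capacity K <= 2%:E / green0].

End Capacity.

(* Main.v *)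
(* Write g for the Green function of the walk, g = 1_0 + Pg with P the one-step
   average, and e for the escape probabilities from K. The hitting probability of
   K is a solution of u = 1_K e + Pu dominated by a potential, and among the
   nonnegative solutions the potential of e is the smallest one. Hence the two
   agree: sum_(y in K) g(x - y) e(y) equals 1 on K and is at most 1 everywhere.
   This makes cap(K) = sum e a quantity of linear algebra and shows that it is
   monotone in K.

   Every bound used on g comes from comparison: h >= 0 and h >= 1_0 + Ph imply
   g <= h, while f <= 1_0 + Pf with f of bounded support implies f <= g. Suitable
   h equal an explicit finite table near 0, found by linear programming, and a
   multiple of 1/sqrt(|x|^2 + 2) far away. A neighbour v of 0 has
   g(v) = g(0) - 1.

   - Two points: cap = 2/(g(0) + g(x - y)).
   - Three points with a, b, c the values of g at the differences: by the
     Cauchy-Schwarz inequality for the Green matrix, cap >= 9/(3 g(0) + 2(a+b+c)),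
     which exceeds 2/g(0) as soon as a + b + c < 3 g(0)/4. By parity at most two
     of the three pairs are adjacent; the bound holds for all triples if d >= 4
     and for the disconnected ones if d = 3.
   - A connected triple with end points at difference u has cap <= 2/g(0) exactly
     when (2 - g(0))^2 <= g(0) g(u), which holds if d = 3.
   - Four points in Z^3: either one of them is adjacent to the three others, which
     then form a disconnected triple, or all column sums of the Green matrix are
     below 2 g(0). *)

From Stdlib Require Import NArith.
Require Import Defs.
From mathcomp Require Import all_boot all_order all_algebra all_fingroup.
From mathcomp Require Import finmap.
From mathcomp Require Import all_classical all_reals all_analysis.
From mathcomp Require Import ring lra zify.

Set Implicit Arguments.
Unset Strict Implicit.
Unset Printing Implicit Defensive.

Import Order.TTheory GRing.Theory Num.Theory numFieldNormedType.Exports.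

Local Open Scope classical_set_scope.
Local Open Scope ring_scope.

(** * Potential theory of the walk *)

Lemma cvg_sumr (R : realType) (I : Type) (r : seq I) (F : I -> nat -> R)
    (l : I -> R) :
  (forall i, F i n @[n --> \oo] --> l i) ->
  \sum_(i <- r) F i n @[n --> \oo] --> \sum_(i <- r) l i.
Proof. by move=> cF; apply: cvg_big => [|i _]; [exact: add_continuous|exact: cF]. Qed.

Section Potential.
Context (R : realType) (d : nat).
Local Notation pt := 'rV[int]_d.
Implicit Types (f h : pt -> R) (x y z : pt) (s : bool * 'I_d).

Definition unit_step s : pt := (-1) ^+ s.1 *: delta_mx 0 s.2.

Definition avg f x : R := (2 * d%:R)^-1 * \sum_s f (x + unit_step s).

Lemma unit_stepN s : unit_step (~~ s.1, s.2) = - unit_step s.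
Proof. by rewrite /unit_step /= signrN scaleNr. Qed.

Lemma avg_ext f h x : f =1 h -> avg f x = avg h x.
Proof. by move=> e; rewrite /avg; under eq_bigr do rewrite e. Qed.

Lemma le_avg f h x : (forall y, f y <= h y) -> avg f x <= avg h x.
Proof.
move=> le; rewrite ler_wpM2l ?invr_ge0 ?mulr_ge0 ?ler0n//.
by apply: ler_sum => s _; exact: le.
Qed.

Lemma avgD f h x : avg (fun y => f y + h y) x = avg f x + avg h x.
Proof. by rewrite /avg big_split mulrDr. Qed.

Lemma avgZ (c : R) f x : avg (fun y => c * f y) x = c * avg f x.
Proof. by rewrite /avg -mulr_sumr mulrCA. Qed.

Lemma avgB f h x : avg (fun y => f y - h y) x = avg f x - avg h x.
Proof. by rewrite /avg sumrB mulrBr. Qed.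

Lemma avg_sum (I : Type) (r : seq I) (F : I -> pt -> R) x :
  avg (fun y => \sum_(i <- r) F i y) x = \sum_(i <- r) avg (F i) x.
Proof. by rewrite /avg exchange_big /= mulr_sumr. Qed.

Lemma avg_cst (c : R) x : (0 < d)%N -> avg (fun=> c) x = c.
Proof.
move=> d0; rewrite /avg sumr_const card_prod card_bool card_ord -[X in _ * X]mulr_natl -natrM.
by rewrite mulKf// pnatr_eq0 muln_eq0 -lt0n.
Qed.

Lemma avg_shift f z x : avg (fun y => f (y - z)) x = avg f (x - z).
Proof. by rewrite /avg; under eq_bigr do rewrite addrAC. Qed.

Lemma avg_opp f x : avg (fun y => f (- y)) x = avg f (- x).
Proof.
have inj : injective (fun s : bool * 'I_d => (~~ s.1, s.2)).
  by move=> [b i] [c j] /= [/negb_inj-> ->].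
rewrite /avg (reindex_inj inj) /=; congr (_ * _).
by apply: eq_bigr => s _; rewrite unit_stepN opprD opprK.
Qed.

Lemma avg_perm f (t : 'S_d) x :
  avg (fun y => f (col_perm t y)) x = avg f (col_perm t x).
Proof.
have inj : injective (fun s : bool * 'I_d => (s.1, (t^-1)%g s.2)).
  by move=> [b i] [c j] /= [-> /perm_inj->].
rewrite /avg [in RHS](reindex_inj inj) /=; congr (_ * _).
apply: eq_bigr => s _; congr f; apply/rowP => j.
by rewrite !mxE /= (can2_eq (permK t) (permKV t)).
Qed.

(** The expected number of visits to 0 at the times 0, ..., n - 1 by the walk from x, generated by
    iterating u -> 1_0 + Pu from 0. *)
Fixpoint green_part (n : nat) x : R :=
  if n is m.+1 then (x == 0)%:R + avg (green_part m) x else 0.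

(** One such h bounds every [green_part n]; its existence is the form in which transience enters
    below. *)
Definition supersolution h :=
  (forall x, 0 <= h x) /\ (forall x, (x == 0)%:R + avg h x <= h x).

Definition green x : R := limn (green_part ^~ x).

Lemma green_part_le_super h n x : supersolution h -> green_part n x <= h x.
Proof.
move=> [h0 hS]; elim: n x => [|n IH] x /=; first exact: h0.
by rewrite (le_trans _ (hS x))// lerD2l le_avg.
Qed.

Lemma green_part_ge0 n x : 0 <= green_part n x.
Proof.
elim: n x => [|n IH] x //=; rewrite addr_ge0// ?ler0n//.
by rewrite mulr_ge0 ?invr_ge0 ?mulr_ge0 ?ler0n// sumr_ge0.
Qed.

Lemma green_partS_ge n x : green_part n x <= green_part n.+1 x.
Proof.
elim: n x => [|n IH] x; first exact: green_part_ge0.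
by rewrite [leLHS]/= [leRHS]/= lerD2l le_avg.
Qed.

Lemma green_part_opp n x : green_part n (- x) = green_part n x.
Proof.
elim: n x => [|n IH] x //=; rewrite oppr_eq0 -avg_opp.
by under avg_ext => y do rewrite IH.
Qed.

Lemma green_part_perm n (t : 'S_d) x :
  green_part n (col_perm t x) = green_part n x.
Proof.
elim: n x => [|n IH] x //=; rewrite -avg_perm.
under avg_ext => y do rewrite IH.
congr ((nat_of_bool _)%:R + _); apply/eqP/eqP => [/rowP e|->].
  by apply/rowP => j; have := e ((t^-1)%g j); rewrite !mxE permKV.
by apply/rowP => j; rewrite !mxE.
Qed.

Hypothesis transient : exists h, supersolution h.

Lemma cvg_green x : green_part ^~ x @ \oo --> green x.
Proof.
have [h hS] := transient.
apply: nondecreasing_is_cvgn.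
  by apply/nondecreasing_seqP => n; exact: green_partS_ge.
by exists (h x) => _ [n _ <-]; exact: green_part_le_super.
Qed.

Lemma green_part_le n x : green_part n x <= green x.
Proof.
apply: nondecreasing_cvgn_le; last by apply/cvg_ex; exists (green x); exact: cvg_green.
by apply/nondecreasing_seqP => m; exact: green_partS_ge.
Qed.

Lemma green_ge0 x : 0 <= green x.
Proof. exact: le_trans (green_part_le 0 x). Qed.

Lemma green_le_super h x : supersolution h -> green x <= h x.
Proof.
move=> hS; apply: limr_le; first by apply/cvg_ex; exists (green x); exact: cvg_green.
by apply: nearW => n; exact: green_part_le_super.
Qed.

Lemma cvg_avg (F : nat -> pt -> R) f x :
  (forall y, F ^~ y @ \oo --> f y) -> (fun n => avg (F n) x) @ \oo --> avg f x.
Proof.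
move=> cF; apply: cvgMr; apply: cvg_sumr => s; exact: cF.
Qed.

Lemma greenE x : green x = (x == 0)%:R + avg green x.
Proof.
have c1 : (fun n => green_part n.+1 x) @ \oo --> green x.
  by rewrite (cvg_shiftS (green_part ^~ x)); exact: cvg_green.
have c2 : (fun n => green_part n.+1 x) @ \oo --> (x == 0)%:R + avg green x.
  by apply: cvgD; [exact: cvg_cst|apply: cvg_avg; exact: cvg_green].
exact: cvg_unique c1 c2.
Qed.

Lemma green_opp x : green (- x) = green x.
Proof. by rewrite /green; under eq_fun do rewrite green_part_opp. Qed.

Lemma green_perm (t : 'S_d) x : green (col_perm t x) = green x.
Proof. by rewrite /green; under eq_fun do rewrite green_part_perm. Qed.


Lemma green_gt0 : 1 <= green 0.
Proof. by rewrite (le_trans _ (green_part_le 1 0))//= eqxx /avg big1// mulr0 addr0. Qed.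

Definition potential (K : seq pt) (c : pt -> R) x : R :=
  \sum_(y <- K) c y * green (x - y).

Lemma charge_sum (K : seq pt) (c : pt -> R) x : uniq K ->
  \sum_(y <- K) c y * (x - y == 0)%:R = (x \in K)%:R * c x.
Proof.
move=> uK; case: (boolP (x \in K)) => xK.
  rewrite (bigD1_seq x)//= subrr eqxx mulr1 big1 ?addr0 ?mul1r// => y yx.
  by rewrite subr_eq0 eq_sym (negbTE yx) mulr0.
rewrite mul0r big_seq big1// => y yK; rewrite subr_eq0.
by case: eqP xK => [->|_ _]; rewrite ?yK// mulr0.
Qed.

(** Each translate g(x - y) satisfies the shifted equation [greenE]; the point masses add up to 1_K
    c. *)
Lemma potentialE (K : seq pt) (c : pt -> R) x : uniq K ->
  potential K c x = (x \in K)%:R * c x + avg (potential K c) x.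
Proof.
move=> uK; rewrite -charge_sum// /potential avg_sum -big_split /=.
by apply: eq_bigr => y _; rewrite avgZ avg_shift -mulrDr -greenE.
Qed.

(** The n-th iterate of u -> 1_K c + Pu from 0, which converges to the potential. *)
Let part_potential (K : seq pt) (c : pt -> R) n x : R :=
  \sum_(y <- K) c y * green_part n (x - y).

Let part_potentialS (K : seq pt) (c : pt -> R) n x : uniq K ->
  part_potential K c n.+1 x =
    (x \in K)%:R * c x + avg (part_potential K c n) x.
Proof.
move=> uK; rewrite -charge_sum// /part_potential avg_sum -big_split /=.
by apply: eq_bigr => y _; rewrite avgZ avg_shift -mulrDr.
Qed.

Let cvg_part_potential (K : seq pt) (c : pt -> R) x :
  part_potential K c n x @[n --> \oo] --> potential K c x.
Proof. by apply: cvg_sumr => y; apply: cvgMr; exact: cvg_green. Qed.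

(** The map u -> 1_K c + Pu is monotone, so its iterates from 0 stay below h, and so does their
    limit. *)
Lemma potential_le_super (K : seq pt) (c : pt -> R) h x : uniq K ->
  (forall y, 0 <= h y) ->
  (forall y, (y \in K)%:R * c y + avg h y <= h y) -> potential K c x <= h x.
Proof.
move=> uK h0 hS.
have le n : forall y, part_potential K c n y <= h y.
  elim: n => [|n IH] y; first by rewrite /part_potential big1// => z; rewrite mulr0.
  by rewrite part_potentialS// (le_trans _ (hS y))// lerD2l le_avg.
have cv := @cvg_part_potential K c x.
rewrite -(cvg_lim _ cv)//; apply: limr_le; first by apply/cvg_ex; eexists; exact: cv.
by apply: nearW => n; exact: le.
Qed.

(* Without a bound by a potential the difference could be a bounded harmonic
   function such as a constant. *)
Lemma sub_le_potential (K B : seq pt) (c b : pt -> R) f x : uniq K -> uniq B ->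
  (forall y, f y <= potential B b y) ->
  (forall y, f y <= (y \in K)%:R * c y + avg f y) -> f x <= potential K c x.
Proof.
move=> uK uB fB fS.
(* The bracket is P^n applied to the dominating potential. One application of the hypothesis on f
   turns the bound for n into the one for n + 1, and the bracket tends to 0. *)
have le n : forall y, f y <=
    part_potential K c n y + (potential B b y - part_potential B b n y).
  elim: n => [|n IH] y.
    rewrite [X in _ <= X + _]big1 ?add0r => [|z _]; last by rewrite mulr0.
    by rewrite [X in _ - X]big1 ?subr0 => [|z _]; rewrite ?mulr0.
  rewrite (le_trans (fS y))// part_potentialS// -addrA lerD2l.
  apply: le_trans (le_avg _ IH) _.
  rewrite avgD lerD2l avgB [potential B b y]potentialE// part_potentialS//.
  by rewrite opprD addrACA subrr add0r.
have cv : part_potential K c n x + (potential B b x - part_potential B b n x)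
    @[n --> \oo] --> potential K c x.
  rewrite -[X in _ --> X]addr0 -[X in _ + X](subrr (potential B b x)).
  by apply: cvgD; [|apply: cvgB; [exact: cvg_cst|]]; exact: cvg_part_potential.
rewrite -(cvg_lim _ cv)//; apply: limr_ge; first by apply/cvg_ex; eexists; exact: cv.
by apply: nearW => n; exact: le.
Qed.

(** * Escape probabilities, equilibrium potential and monotonicity of capacity *)

Hypothesis d_gt0 : (0 < d)%N.

(** The probability that X_1, ..., X_n all lie outside K, by first-step analysis. The starting point
    itself is not tested, as in the definition of the return time. *)
Fixpoint avoid (K : seq pt) (n : nat) x : R :=
  if n is m.+1 then avg (fun y => (y \notin K)%:R * avoid K m y) x else 1.

Definition escape (K : seq pt) x : R := limn (avoid K ^~ x).

Definition rcap (K : seq pt) : R := \sum_(x <- K) escape K x.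

Lemma avoid_ge0 K n x : 0 <= avoid K n x.
Proof.
elim: n x => [|n IH] x //=; rewrite -[leLHS](avg_cst 0 x d_gt0).
by apply: le_avg => y; rewrite mulr_ge0.
Qed.

Lemma avoidS_le K n x : avoid K n.+1 x <= avoid K n x.
Proof.
elim: n x => [|n IH] x.
  rewrite -[leRHS](avg_cst 1 x d_gt0); apply: le_avg => y.
  by rewrite mulr1 lern1; case: (_ \notin _).
rewrite [leLHS]/= [leRHS]/=; apply: le_avg => y.
by apply: ler_wpM2l => //; exact: IH.
Qed.

Lemma cvg_escape K x : avoid K n x @[n --> \oo] --> escape K x.
Proof.
apply: nonincreasing_is_cvgn.
  by apply/nonincreasing_seqP => n; exact: avoidS_le.
by exists 0 => _ [n _ <-]; exact: avoid_ge0.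
Qed.

Lemma escape_ge0 K x : 0 <= escape K x.
Proof.
apply: limr_ge; first by apply/cvg_ex; exists (escape K x); exact: cvg_escape.
by apply: nearW => n; exact: avoid_ge0.
Qed.

Lemma escapeE K x :
  escape K x = avg (fun y => (y \notin K)%:R * escape K y) x.
Proof.
have c1 : (fun n => avoid K n.+1 x) @ \oo --> escape K x.
  by rewrite (cvg_shiftS (avoid K ^~ x)); exact: cvg_escape.
have c2 : (fun n => avoid K n.+1 x) @ \oo -->
    avg (fun y => (y \notin K)%:R * escape K y) x.
  by apply: cvg_avg => y; apply: cvgMr; exact: cvg_escape.
exact: cvg_unique c1 c2.
Qed.

(** The probability of visiting K at some time n >= 0; it is 1 on K. *)
Let hit K x : R := 1 - (x \notin K)%:R * escape K x.

(** By [escapeE] the average of [hit K] is 1 - [escape K x] at every x. *)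
Let hitE K x : hit K x = (x \in K)%:R * escape K x + avg (hit K) x.
Proof.
rewrite /hit avgB avg_cst// -escapeE; case: (x \in K) => /=; first by ring.
by ring.
Qed.

Let hit_ge0 K x : 0 <= hit K x.
Proof.
rewrite /hit subr_ge0; case: (x \notin K); rewrite ?mul0r// mul1r.
apply: limr_le; first by apply/cvg_ex; exists (escape K x); exact: cvg_escape.
apply: nearW; elim=> [|n IH] //; exact: le_trans (avoidS_le _ _ _) IH.
Qed.

(** The probability of visiting K by time n is at most the expected number of visits to K, the
    potential of the unit charge. This is the domination that [sub_le_potential] asks for. *)
Let hit_le K x : uniq K -> hit K x <= potential K (fun=> 1) x.
Proof.
move=> uK.
have p0 y : 0 <= potential K (fun=> 1) y.
  by apply: sumr_ge0 => z _; rewrite mul1r green_ge0.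
have le n : forall y, 1 - (y \notin K)%:R * avoid K n y <= potential K (fun=> 1) y.
  have ap0 y : 0 <= avg (potential K (fun=> 1)) y.
    by rewrite -[leLHS](avg_cst 0 y d_gt0); exact: le_avg.
  elim: n => [|n IH] y; rewrite potentialE// mulr1; have [yK|yK] := boolP (y \in K) => /=.
  - by rewrite mul0r subr0 lerDl.
  - by rewrite mulr1 subrr add0r.
  - by rewrite mul0r subr0 lerDl.
  - rewrite mul1r add0r -[X in X - _](avg_cst 1 y d_gt0) -avgB; exact: le_avg.
have cv : 1 - (x \notin K)%:R * avoid K n x @[n --> \oo] --> hit K x.
  by apply: cvgB; [exact: cvg_cst|apply: cvgMr; exact: cvg_escape].
rewrite -(cvg_lim _ cv)//; apply: limr_le; first by apply/cvg_ex; eexists; exact: cv.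
by apply: nearW => n; exact: le.
Qed.

Lemma potential_escape K x : uniq K ->
  potential K (escape K) x = 1 - (x \notin K)%:R * escape K x.
Proof.
move=> uK; apply/eqP; rewrite eq_le; apply/andP; split.
  by apply: (potential_le_super (h := hit K) _ uK) => y; [exact: hit_ge0|rewrite -hitE].
apply: (sub_le_potential (f := hit K) (b := fun=> 1) _ uK uK) => y.
  exact: hit_le.
by rewrite -hitE.
Qed.

(** The potential of e_K is 1 on S, so cap(S) is the double sum of e_S(x) g(x - y) e_K(y). Summed
    over x first, it is the sum of e_K against the potential of e_S, which is at most 1. *)
Lemma rcap_le (S K : seq pt) : uniq S -> uniq K -> {subset S <= K} ->
  rcap S <= rcap K.
Proof.
move=> uS uK SK.
have -> : rcap S = \sum_(x <- S) escape S x * potential K (escape K) x.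
  rewrite /rcap [LHS]big_seq [RHS]big_seq; apply: eq_bigr => x xS.
  by rewrite potential_escape// (SK _ xS) mul0r subr0 mulr1.
under eq_bigr do rewrite /potential mulr_sumr.
rewrite exchange_big /=; apply: ler_sum => y _.
rewrite (eq_bigr (fun x => escape K y * (escape S x * green (y - x)))); last first.
  by move=> x _; rewrite -opprB green_opp mulrCA.
rewrite -mulr_sumr -[leRHS]mulr1 ler_wpM2l ?escape_ge0//.
rewrite -[X in X <= _]/(potential S (escape S) y) potential_escape//.
by rewrite lerBlDr lerDl mulr_ge0 ?escape_ge0.
Qed.

End Potential.

(** * Events of the random walk *)

Lemma adde_eqr_eq0 (R : realDomainType) (a b : \bar R) :
  b \is a fin_num -> (b = a + b -> a = 0)%E.
Proof.
by move: a b => [a| |] [b| |] //= _ [] /eqP; rewrite -subr_eq subrr => /eqP <-.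
Qed.

Section Fibers.
Local Open Scope ereal_scope.
Context (R : realType) (disp : measure_display) (T : measurableType disp).
Context (mu : probability T R) (Z : eqType) (Y : T -> Z).
Hypothesis mY : forall z, measurable (Y @^-1` [set z]).

Lemma measurable_fiber_seq (r : seq Z) : measurable [set w | Y w \in r].
Proof.
elim: r => [|z r IH]; first by rewrite (_ : [set _ | _] = set0)// -subset0 => w.
rewrite (_ : [set _ | _] = Y @^-1` [set z] `|` [set w | Y w \in r]).
  exact: measurableU.
apply/seteqP; split => w /=; rewrite inE; first by move=> /orP[/eqP|]; [left|right].
by move=> [->|->]; rewrite ?eqxx ?orbT.
Qed.

Lemma measure_fiber_seq (r : seq Z) A : uniq r -> measurable A ->
  mu (A `&` [set w | Y w \in r]) = \sum_(z <- r) mu (A `&` Y @^-1` [set z]).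
Proof.
elim: r => [|z r IH] /=.
  by rewrite big_nil (_ : [set _ | _] = set0) ?setI0 ?measure0// -subset0 => w.
move=> /andP[zr ur] mA; rewrite big_cons -IH// -measureU//.
- congr (mu _); apply/seteqP; split => w /=; rewrite inE.
    by move=> [Aw /orP[/eqP|]]; [left|right].
  by move=> [[Aw ->]|[Aw ->]]; rewrite ?eqxx ?orbT.
- exact: measurableI.
- by apply: measurableI => //; exact: measurable_fiber_seq.
- by rewrite -subset0 => w /= [[_ Yz] [_]]; rewrite Yz (negbTE zr).
Qed.

(** The hypothesis on A says that Y lies in r almost surely on A; the part of B where Y is outside r
    is then null as well. *)
Lemma measure_fibers (r : seq Z) A B : uniq r -> measurable A -> measurable B ->
    B `<=` A -> mu A = \sum_(z <- r) mu (A `&` Y @^-1` [set z]) ->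
  mu B = \sum_(z <- r) mu (B `&` Y @^-1` [set z]).
Proof.
move=> ur mA mB BA; rewrite -measure_fiber_seq// -measure_fiber_seq// => e.
have mr := measurable_fiber_seq r.
rewrite (measureDI mu mB mr).
have e0 := e; rewrite (measureDI mu mA mr) in e0.
rewrite -[RHS]add0e; congr (_ + _).
apply: (@subset_measure0 _ _ _ _ _ (A `\` [set w | Y w \in r])).
- exact: measurableD.
- exact: measurableD.
- exact: setSD.
- apply: adde_eqr_eq0 (esym e0); rewrite fin_num_measure//; exact: measurableI.
Qed.

End Fibers.

(** * Cylinder events and the Markov property *)

Section Walk.
Context (R : realType) (d : nat).
Context (disp : measure_display) (Omega : measurableType disp).
Context (P : 'rV[int]_d -> probability Omega R).
Context (X : nat -> Omega -> 'rV[int]_d).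
Hypothesis d_gt0 : (0 < d)%N.
Hypothesis hX : simple_random_walk P X.
Local Notation pt := 'rV[int]_d.
Implicit Types (x y : pt) (z : nat -> pt).

Lemma lattice_adj_step x s : lattice_adj x (x + unit_step s).
Proof.
rewrite /lattice_adj (bigD1 s.2)//= !mxE (eqxx s.2) (eqxx (0 : 'I_1)) opprD addNKr normrN mulr1.
rewrite normrX normrN1 expr1n big1 ?addr0// => i /negbTE ne.
by rewrite !mxE eqxx ne mulr0 addr0 subrr normr0.
Qed.

Lemma unit_step_inj : injective (@unit_step d).
Proof.
move=> [b i] [c j] /rowP /(_ i); rewrite !mxE /= eqxx mulr1.
have [<-|_] := eqVneq i j; first by rewrite mulr1; case: b c => [] [].
by rewrite mulr0 => /eqP; rewrite signr_eq0.
Qed.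

(** [wt x n z] is the probability of [cyl n z] under P_x, and [upd n z y] prolongs the path z_0,
    ..., z_n by a step to y. *)
Let cyl n z := [set w | forall k, (k <= n)%N -> X k w = z k].
Let wt x n z : R := (z 0%N == x)%:R * \prod_(k < n) srw_step R (z k) (z k.+1).
Let upd n z y : nat -> pt := fun k => if (k <= n)%N then z k else y.

Let mX n y : measurable (X n @^-1` [set y]).
Proof. by case: hX. Qed.

Let cylS n z y : cyl n.+1 (upd n z y) = cyl n z `&` X n.+1 @^-1` [set y].
Proof.
apply/seteqP; split => w /= => [h|[h e]].
  split; last by have := h _ (leqnn _); rewrite /upd ltnn.
  by move=> k kn; have := h _ (leqW kn); rewrite /upd kn.
move=> k; rewrite leq_eqVlt => /orP[/eqP->|kn]; first by rewrite /upd ltnn.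
by rewrite /upd -ltnS kn h.
Qed.

Let measurable_cyl n z : measurable (cyl n z).
Proof.
elim: n => [|n IH].
  rewrite (_ : cyl 0 z = X 0%N @^-1` [set z 0%N])//.
  apply/seteqP; split => w /= => [/(_ _ (leqnn _))//|e k].
  by rewrite leqn0 => /eqP->.
rewrite (_ : cyl n.+1 z = cyl n z `&` X n.+1 @^-1` [set z n.+1]).
  exact: measurableI.
apply/seteqP; split => w /= => [h|[h e] k].
  by split => [k kn|]; apply: h => //; exact: leqW.
by rewrite leq_eqVlt => /orP[/eqP->|] //; exact: h.
Qed.

Let wtS x n z y : wt x n.+1 (upd n z y) = wt x n z * srw_step R (z n) y.
Proof.
rewrite /wt big_ord_recr /= /upd leqnn ltnn mulrA; congr (_ * _ * _).
by apply: eq_bigr => k _; rewrite ltnW// ltn_ord.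
Qed.

(** The weights of the 2d prolongations of a cylinder add up to its own weight, so almost surely on
    the cylinder the next position is a neighbour of z_n. *)
Let one_step x n z A : measurable A ->
  P x (cyl n z `&` A) =
    (\sum_s P x (cyl n.+1 (upd n z (z n + unit_step s)) `&` A))%E.
Proof.
move=> mA; pose r := [seq z n + unit_step s | s : bool * 'I_d].
have ur : uniq r by rewrite map_inj_uniq ?enum_uniq// => s t /addrI/unit_step_inj.
rewrite (measure_fibers (mX n.+1) ur (measurable_cyl n z)).
- rewrite /r big_map big_enum /=; apply: eq_bigr => s _.
  by rewrite cylS setIAC.
- exact: measurableI.
- exact: subIsetl.
rewrite /r big_map big_enum /= (hX.2) -/(wt x n z).
under eq_bigr => s _ do rewrite -cylS (hX.2) -/(wt x n.+1 _) wtS /srw_step lattice_adj_step.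
rewrite sumEFin -mulr_sumr sumr_const card_prod card_bool card_ord.
rewrite -[X in _ * X]mulr_natl natrM mulfV ?mulr1//.
by rewrite -natrM pnatr_eq0 muln_eq0 -lt0n.
Qed.

Let avg_wt x n z f :
  (\sum_s (wt x n.+1 (upd n z (z n + unit_step s)) * f (z n + unit_step s))%:E)%E =
  (wt x n z * avg f (z n))%:E.
Proof.
rewrite sumEFin /avg mulrA mulr_sumr; congr (_%:E); apply: eq_bigr => s _.
by rewrite wtS /srw_step lattice_adj_step.
Qed.

Let updS n z y : upd n z y n.+1 = y.
Proof. by rewrite /upd ltnn. Qed.

(** The Markov property at time n: the cylinder contributes its weight and the walk restarts at z_n.
    The induction on m lets n and z vary because the cylinder grows. *)
Let walk_at_cyl x y m n z :
  P x (cyl n z `&` X (n + m)%N @^-1` [set y]) =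
    (wt x n z * iter m (@avg R d) (fun u => (u == y)%:R) (z n))%:E.
Proof.
elim: m n z => [|m IH] n z.
  rewrite addn0 /=; have [<-|ne] := eqVneq (z n) y.
    rewrite mulr1 -(hX.2) setIidl// => w; exact.
  rewrite mulr0 (_ : _ `&` _ = set0) ?measure0// -subset0 => w /= [h e].
  by move/eqP: ne; apply; rewrite -h.
rewrite one_step//= -avg_wt; apply: eq_bigr => s _.
by rewrite addnS -addSn IH updS.
Qed.

(** P_x(X_0 = x) = 1 puts every event inside a cylinder, where the Markov property applies. *)
Let start x A : measurable A -> P x A = P x (cyl 0 (fun=> x) `&` A).
Proof.
move=> mA; have mC := measurable_cyl 0 (fun=> x).
have C1 : P x (cyl 0 (fun=> x)) = 1%E by rewrite hX.2 eqxx big_ord0 mulr1.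
have C0 : P x (~` cyl 0 (fun=> x)) = 0%E by rewrite probability_setC// C1 subee.
rewrite setIC (measureDI (P x) mA mC) -[RHS]add0e; congr (_ + _)%E.
apply: (@subset_measure0 _ _ _ _ _ (~` cyl 0 (fun=> x))).
- exact: measurableD.
- exact: measurableC.
- by move=> w [].
- exact: C0.
Qed.

Lemma walk_at x n y : P x (X n @^-1` [set y]) =
  (iter n (@avg R d) (fun u => (u == y)%:R) x)%:E.
Proof.
by rewrite start// (walk_at_cyl x y n 0) /wt eqxx big_ord0 !mul1r.
Qed.

Let avoids (K : seq pt) n m :=
  [set w | forall j, (0 < j <= m)%N -> X (n + j)%N w \notin K].

Let avoidsS K n m :
  avoids K n m.+1 = [set w | X n.+1 w \notin K] `&` avoids K n.+1 m.
Proof.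
apply/seteqP; split => w /= => [h|[h1 h] [//|[|j] jm]].
- split; first by have := h 1%N isT; rewrite addn1.
  by move=> j /andP[j0 jm]; rewrite addSn -addnS; exact: h.
- by rewrite addn1.
- by rewrite addnS -addSn; apply: h; rewrite ltnS in jm.
Qed.

Let measurable_avoids K n m : measurable (avoids K n m).
Proof.
elim: m n => [|m IH] n.
  by rewrite (_ : avoids _ _ _ = setT)//; apply/seteqP; split => w // _ [].
rewrite avoidsS; apply: measurableI => //.
rewrite (_ : [set _ | _] = ~` [set w | X n.+1 w \in K]).
  by apply: measurableC; exact: measurable_fiber_seq.
by apply/seteqP; split => w /= /negP.
Qed.

Let avoids_cyl x K m n z :
  P x (cyl n z `&` avoids K n m) = (wt x n z * avoid R K m (z n))%:E.
Proof.
elim: m n z => [|m IH] n z.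
  by rewrite mulr1 -(hX.2) setIidl// => w _ [].
rewrite one_step//= -avg_wt; apply: eq_bigr => s _.
rewrite avoidsS setIA; set y := z n + unit_step s.
have [yK|yK] := boolP (y \in K).
  rewrite mul0r mulr0 (_ : _ `&` _ = set0) ?measure0// -subset0 => w /= [[h]].
  by rewrite h// updS yK.
have := IH n.+1 (upd n z y); rewrite updS mul1r => <-; congr (P x (_ `&` _)).
by apply: setIidl => w h /=; rewrite h// updS.
Qed.

(** The hitting time is infinite exactly on the intersection of the events of avoiding K during m
    steps. These decrease in m, so continuity from above applies. *)
Lemma escape_prob x (K : {fset pt}) :
  P x [set w | hitting_time R X K w = +oo%E] = (escape R (enum_fset K) x)%:E.
Proof.
set K' := enum_fset K.
have -> : [set w | hitting_time R X K w = +oo%E] = \bigcap_m avoids K' 0 m.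
  apply/seteqP; split => w /=.
    move=> /ereal_inf_pinfty h m _ j /andP[j0 _]; rewrite add0n; apply/negP => XK.
    by have // : j%:R%:E = +oo%E :> \bar R by apply: h; exists j.
  move=> h; apply/ereal_inf_pinfty => _ [j [j0 XK] <-].
  by have := h j I j; rewrite j0 leqnn add0n => /(_ isT) /negP.
have cv : (P x \o avoids K' 0) m @[m --> \oo] --> P x (\bigcap_m avoids K' 0 m).
  apply: nonincreasing_cvg_mu => //.
  - by rewrite (le_lt_trans (probability_le1 _ _))// ltry.
  - exact: bigcapT_measurable.
  - apply/nonincreasing_seqP => m; apply/subsetPset => w h j /andP[j0 jm].
    by apply: h; rewrite j0 leqW.
have cv2 : (P x \o avoids K' 0) m @[m --> \oo] --> (escape R K' x)%:E.
  rewrite (_ : _ \o _ = fun m => (avoid R K' m x)%:E).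
    by apply: cvg_EFin; [exact: nearW|exact: cvg_escape].
  apply/funext => m /=.
  by rewrite start// avoids_cyl /wt eqxx big_ord0 !mul1r.
exact: cvg_unique cv cv2.
Qed.

End Walk.

(** * Capacity and g(0) as real numbers *)

Section CapacityReal.
Context (R : realType) (d : nat).
Context (disp : measure_display) (Omega : measurableType disp).
Context (P : 'rV[int]_d -> probability Omega R).
Context (X : nat -> Omega -> 'rV[int]_d).
Hypothesis d_gt0 : (0 < d)%N.
Hypothesis hX : simple_random_walk P X.
Hypothesis transient : exists h : 'rV[int]_d -> R, supersolution h.

Lemma green_part_iter n x :
  green_part R n x = \sum_(m < n) iter m (@avg R d) (fun u => (u == 0)%:R) x.
Proof.
elim: n x => [|n IH] x; first by rewrite big_ord0.
rewrite big_ord_recl /=; congr (_ + _).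
by rewrite -avg_sum; apply: avg_ext => y; rewrite IH.
Qed.

Lemma green0E : green0 P X = (green R (0 : 'rV[int]_d))%:E.
Proof.
rewrite /green0; apply: cvg_lim => //.
rewrite (_ : (fun n => _) = fun n => (green_part R n (0 : 'rV[int]_d))%:E).
  by apply: cvg_EFin; [exact: nearW|exact: cvg_green].
apply/funext => n; rewrite green_part_iter -sumEFin big_mkord.
by apply: eq_bigr => m _; rewrite -(walk_at d_gt0 hX).
Qed.

Lemma capacityE K : capacity P X K = (rcap R (enum_fset K))%:E.
Proof.
rewrite /capacity /rcap -sumEFin; apply: eq_bigr => x _.
exact: escape_prob.
Qed.

Lemma small_capacity_setsE K : small_capacity_sets P X K =
  (K != fset0 /\ rcap R (enum_fset K) <= 2 / green R (0 : 'rV[int]_d)).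
Proof.
rewrite /small_capacity_sets /= capacityE green0E.
by rewrite inver gt_eqF ?(lt_le_trans ltr01)// ?green_gt0.
Qed.

End CapacityReal.

(** * Superharmonic functions *)

Section InverseSqrt.
Context {R : realType}.
Implicit Types t y z : R.

(** The Taylor coefficients are 3/4 and 35/64; raising the latter to 7/10 pays for all higher terms
    up to t = 1/2. With p and q the two roots, the sum is (p + q)/(pq), where (p + q)^2 = 2 + 2pq
    and (pq)^2 = 1 - t^2, so only polynomials in y = t^2 remain. *)
Lemma inv_sqrt_pair_le t : 0 <= t <= 1 / 2 ->
  (Num.sqrt (1 + t))^-1 + (Num.sqrt (1 - t))^-1 <=
  2 + 3 / 4 * t ^+ 2 + 7 / 10 * t ^+ 4.
Proof.
move=> /andP[t0 t1].
have p0 : 0 < Num.sqrt (1 + t) by rewrite sqrtr_gt0; lra.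
have q0 : 0 < Num.sqrt (1 - t) by rewrite sqrtr_gt0; lra.
have p2 : Num.sqrt (1 + t) ^+ 2 = 1 + t by rewrite sqr_sqrtr//; lra.
have q2 : Num.sqrt (1 - t) ^+ 2 = 1 - t by rewrite sqr_sqrtr//; lra.
move: (Num.sqrt (1 + t)) (Num.sqrt (1 - t)) p0 q0 p2 q2 => p q p0 q0 p2 q2.
have y0 : 0 <= t ^+ 2 by apply: sqr_ge0.
have y1 : t ^+ 2 <= 1 / 4 by nra.
rewrite (_ : t ^+ 4 = t ^+ 2 ^+ 2); last by rewrite -exprM.
have w2 : (p * q) ^+ 2 = 1 - t ^+ 2 by rewrite exprMn p2 q2; ring.
have -> : p^-1 + q^-1 = (p + q) / (p * q) by field; rewrite !gt_eqF.
have w0 : 0 < p * q by rewrite mulr_gt0.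
have s2 : (p + q) ^+ 2 = 2 + 2 * (p * q) by rewrite sqrrD p2 q2 -mulr_natl; ring.
move: (t ^+ 2) y0 y1 w2 => y y0 y1 w2.
(* The Taylor polynomial of sqrt(1 - y), whose omitted terms are all negative. *)
have wle : p * q <= 1 - y / 2 - y ^+ 2 / 8 - y ^+ 3 / 16.
  rewrite -ler_sqr ?nnegrE; [|exact: ltW|by nra].
  rewrite w2 -subr_ge0.
  have -> : (1 - y / 2 - y ^+ 2 / 8 - y ^+ 3 / 16) ^+ 2 - (1 - y) =
    y ^+ 4 * (5 / 64 + y / 64 + y ^+ 2 / 256) by field.
  by rewrite mulr_ge0 ?exprn_ge0// !addr_ge0 ?divr_ge0 ?exprn_ge0//.
have P0 : 0 <= 2 + 3 / 4 * y + 7 / 10 * y ^+ 2 by nra.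
rewrite ler_pdivrMr// -ler_sqr ?nnegrE; [|by rewrite ltW ?addr_gt0|by rewrite mulr_ge0// ltW].
rewrite s2 exprMn w2.
have : 2 + 2 * (p * q) <= 4 - y - y ^+ 2 / 4 - y ^+ 3 / 8 by lra.
move=> /le_trans; apply; rewrite -subr_ge0.
have -> : (2 + 3 / 4 * y + 7 / 10 * y ^+ 2) ^+ 2 * (1 - y) -
   (4 - y - y ^+ 2 / 4 - y ^+ 3 / 8) =
   y ^+ 2 * (49/80 - 35/16 * y - 14/25 * y ^+ 2 - 49/100 * y ^+ 3) by field.
rewrite mulr_ge0 ?sqr_ge0//.
have : y ^+ 2 <= 1 / 4 * y by nra.
have : y ^+ 3 <= 1 / 16 * y by nra.
lra.
Qed.

Lemma inv_sqrt_ge z : 0 <= z < 1 ->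
  1 + z / 2 + 3 / 8 * z ^+ 2 <= (Num.sqrt (1 - z))^-1.
Proof.
move=> /andP[z0 z1].
have q0 : 0 < Num.sqrt (1 - z) by rewrite sqrtr_gt0; lra.
have q2 : Num.sqrt (1 - z) ^+ 2 = 1 - z by rewrite sqr_sqrtr//; lra.
have P0 : 0 <= 1 + z / 2 + 3 / 8 * z ^+ 2 by nra.
rewrite -[leRHS]mul1r ler_pdivlMr// -ler_sqr ?nnegrE; [|by rewrite mulr_ge0// ltW|by []].
rewrite exprMn q2 expr1n -subr_ge0.
have -> : 1 - (1 + z / 2 + 3 / 8 * z ^+ 2) ^+ 2 * (1 - z) =
  z ^+ 3 * (5 / 8 + 15 / 64 * z + 9 / 64 * z ^+ 2) by field.
by rewrite mulr_ge0 ?exprn_ge0// !addr_ge0 ?mulr_ge0 ?exprn_ge0//; lra.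
Qed.

(* [1/sqrt(|x|^2 + 2)] is superharmonic for |x|^2 >= 9 in every dimension
   d >= 3; the shift by 2 absorbs the fourth order term of the discrete
   Laplacian of 1/|x|. *)
Definition tail (k : nat) : R := (Num.sqrt k.+2%:R)^-1.

Lemma tail_gt0 k : 0 < tail k.
Proof. by rewrite invr_gt0 sqrtr_gt0 ltr0n. Qed.

Lemma tail_sqr k : tail k ^+ 2 = k.+2%:R^-1.
Proof. by rewrite exprVn sqr_sqrtr// ler0n. Qed.

Lemma tail_le k l : (k <= l)%N -> tail l <= tail k.
Proof.
by move=> kl; rewrite lef_pV2 ?posrE ?sqrtr_gt0 ?ltr0n// ler_sqrt ?ltr0n// ler_nat.
Qed.

(** The share of one coordinate m = |x_i| in superharmonicity at |x|^2 = k; the sum over i, with the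
    squares m^2 adding up to k, leaves the factor 6. Scaling by V = k + 3 with t = 2m/V reduces it
    to the two Taylor bounds above. *)
Lemma tail_coord k m : (9 <= k)%N -> (m ^ 2 <= k)%N ->
  k%:R * (tail (k.+1 + 2 * m) + tail (k.+1 - 2 * m) - 2 * tail k.+1) <=
  6 * m%:R ^+ 2 * (tail k - tail k.+1).
Proof.
(* From 2m <= m^2 + 1, so the subtraction in the statement is not truncated. *)
move=> k9 mk; have m2k : (2 * m <= k.+1)%N.
  by have [+ _] := nat_Cauchy m 1; rewrite muln1 exp1n addn1 => /leq_trans; apply.
pose V : R := k.+3%:R; pose t := 2 * m%:R / V.
have V12 : 12 <= V by rewrite ler_nat !ltnS.
have V0 : 0 < V by lra.
have kV : k%:R = V - 3 by rewrite /V -addn3 natrD addrK.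
have mV : m%:R ^+ 2 <= V - 3 by rewrite -kV -natrX ler_nat.
have scale u : 0 < u -> Num.sqrt (V * u) = Num.sqrt V * Num.sqrt u.
  by move=> u0; rewrite sqrtrM// ltW.
have m0 : 0 <= m%:R :> R by [].
have t0 : 0 <= t by rewrite divr_ge0 ?mulr_ge0// ltW.
have t2 : t ^+ 2 = 4 * m%:R ^+ 2 / V ^+ 2 by rewrite /t; field; lra.
have t2k : t ^+ 2 * V ^+ 2 <= 4 * (V - 3).
  by rewrite t2 divfK ?expf_neq0 ?gt_eqF//; lra.
have t1 : t <= 1 / 2.
  rewrite -ler_sqr ?nnegrE//.
  have : 16 * (V - 3) <= V ^+ 2 by nra.
  move=> h; have : t ^+ 2 * V ^+ 2 <= (1 / 2) ^+ 2 * V ^+ 2 by lra.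
  by rewrite ler_pM2r// exprn_gt0.
have e1 : tail (k.+1 + 2 * m) = (Num.sqrt V)^-1 * (Num.sqrt (1 + t))^-1.
  rewrite -invfM -scale; last by lra.
  congr (Num.sqrt _)^-1; rewrite /t mulrDr mulr1 mulrCA divff ?gt_eqF// mulr1.
  by rewrite /V -natrM -natrD -!addSn.
have e2 : tail (k.+1 - 2 * m) = (Num.sqrt V)^-1 * (Num.sqrt (1 - t))^-1.
  rewrite -invfM -scale; last by lra.
  congr (Num.sqrt _)^-1; rewrite /t mulrBr mulr1 mulrCA divff ?gt_eqF// mulr1.
  have -> : (k.+1 - 2 * m).+2 = (k.+3 - 2 * m)%N by lia.
  by rewrite natrB ?natrM//; lia.
have e3 : tail k = (Num.sqrt V)^-1 * (Num.sqrt (1 - V^-1))^-1.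
  rewrite -invfM -scale; last by rewrite subr_gt0 invf_lt1//; lra.
  congr (Num.sqrt _)^-1; rewrite mulrBr mulr1 divff ?gt_eqF//.
  by rewrite /V [in RHS]mulrS addrAC subrr add0r.
have e4 : tail k.+1 = (Num.sqrt V)^-1 by [].
have w0 : 0 <= (Num.sqrt V)^-1 by rewrite invr_ge0 sqrtr_ge0.
rewrite e1 e2 e3 e4 kV.
have hE := @inv_sqrt_pair_le t; rewrite t0 t1 in hE; have {}hE := hE isT.
have hZ : 1 + V^-1 / 2 + 3 / 8 * V^-1 ^+ 2 <= (Num.sqrt (1 - V^-1))^-1.
  by apply: inv_sqrt_ge; rewrite invr_ge0 ltW//= invf_lt1//; lra.
move: (Num.sqrt V)^-1 w0 (Num.sqrt (1 + t))^-1 (Num.sqrt (1 - t))^-1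
  (Num.sqrt (1 - V^-1))^-1 hE hZ => w w0 a b c hE hZ.
have -> : (V - 3) * (w * a + w * b - 2 * w) = w * ((V - 3) * (a + b - 2)) by ring.
have -> : 6 * m%:R ^+ 2 * (w * c - w) = w * (6 * m%:R ^+ 2 * (c - 1)) by ring.
apply: ler_wpM2l => //.
have my : m%:R ^+ 2 = t ^+ 2 * V ^+ 2 / 4 by rewrite t2; field; lra.
rewrite my; have y0 := sqr_ge0 t.
apply: (@le_trans _ _ ((V - 3) * (3 / 4 * t ^+ 2 + 7 / 10 * t ^+ 4))).
  by rewrite ler_wpM2l//; lra.
apply: (@le_trans _ _ (6 * (t ^+ 2 * V ^+ 2 / 4) *
  (V^-1 / 2 + 3 / 8 * V^-1 ^+ 2))); last first.
  apply: ler_wpM2l; last by rewrite lerBrDl addrA.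
  by rewrite !mulr_ge0 ?exprn_ge0 ?invr_ge0// ltW.
have -> : 6 * (t ^+ 2 * V ^+ 2 / 4) * (V^-1 / 2 + 3 / 8 * V^-1 ^+ 2) =
  t ^+ 2 * (3 / 4 * V + 9 / 16) by field; lra.
have -> : (V - 3) * (3 / 4 * t ^+ 2 + 7 / 10 * t ^+ 4) =
  t ^+ 2 * (3 / 4 * (V - 3) + 7 / 10 * (t ^+ 2 * (V - 3))) by ring.
rewrite ler_wpM2l//.
(* What remains is 7/10 times 4, that is 2.8, against 9/4 + 9/16 = 2.8125; the 9/4 comes from k = V
   - 3 and thus from the shift in [tail]. *)
suff : t ^+ 2 * (V - 3) <= 4 by lra.
rewrite -(ler_pM2r (exprn_gt0 2 V0)).
have : (V - 3) * (t ^+ 2 * V ^+ 2) <= (V - 3) * (4 * (V - 3)).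
  by rewrite ler_wpM2l//; lra.
nra.
Qed.

End InverseSqrt.

(** * Radial functions on the lattice *)

Section Radial.
Context (R : realType) (d : nat).
Local Notation pt := 'rV[int]_d.
Implicit Types (x : pt) (tau : nat -> R).

Definition nsq x : nat := (\sum_i `|x ord0 i| ^ 2)%N.

Definition norm1 x : nat := (\sum_i `|x ord0 i|)%N.

(* {|a - 1|, |a + 1|} = {down |a|, |a| + 1} for every integer a. *)
Definition down (m : nat) : nat := if m is m'.+1 then m' else 1%N.

Lemma absz_steps (phi : nat -> R) (a : int) :
  phi `|(a + 1)%R|%N + phi `|(a - 1)%R|%N = phi `|a|.+1 + phi (down `|a|).
Proof.
case: a => [[|n]|n].
- by [].
- by congr (phi _ + phi _) => /=; lia.
- by rewrite addrC; congr (phi _ + phi _) => /=; lia.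
Qed.

Lemma sum_steps (f : pt -> R) x :
  \sum_s f (x + unit_step s) =
  \sum_i (f (x + delta_mx ord0 i) + f (x - delta_mx ord0 i)).
Proof.
transitivity (\sum_(b : bool) \sum_i f (x + unit_step (b, i))).
  by rewrite pair_bigA; apply: eq_bigr => -[].
rewrite big_bool /= addrC -big_split; apply: eq_bigr => i _.
by rewrite /unit_step /= scale1r scaleN1r.
Qed.

Lemma nsq_shift x (a : int) i :
  nsq (x + a *: delta_mx ord0 i) = (nsq x - `|x ord0 i| ^ 2 + `|(x ord0 i + a)%R| ^ 2)%N.
Proof.
rewrite /nsq (bigD1 i)//= [in RHS](bigD1 i)//= addnC addKn; congr (_ + _)%N.
  by apply: eq_bigr => j /negbTE ji; rewrite !mxE ji andbF mulr0 addr0.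
by rewrite !mxE !eqxx mulr1.
Qed.

Lemma le_nsq x i : (`|x ord0 i| ^ 2 <= nsq x)%N.
Proof. by rewrite /nsq (bigD1 i)//= leq_addr. Qed.

Lemma nsq_gt0 x : x != 0 -> (0 < nsq x)%N.
Proof.
apply: contraNT; rewrite -leqNgt leqn0 sum_nat_eq0 => /forallP h.
by apply/eqP/rowP => i; have := h i; rewrite expn_eq0 andbT absz_eq0 mxE => /eqP.
Qed.

Lemma radial_steps tau x :
  \sum_s tau (nsq (x + unit_step s)) =
  \sum_i (tau ((nsq x).+1 + 2 * `|x ord0 i|)%N +
          tau ((nsq x).+1 - 2 * `|x ord0 i|)%N).
Proof.
rewrite (sum_steps (fun y => tau (nsq y))); apply: eq_bigr => i _.
have le := le_nsq x i.
have -> : x + delta_mx ord0 i = x + 1 *: delta_mx ord0 i by rewrite scale1r.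
have -> : x - delta_mx ord0 i = x + (- 1) *: delta_mx ord0 i by rewrite scaleN1r.
rewrite !nsq_shift (absz_steps (fun k => tau (nsq x - `|x ord0 i| ^ 2 + k ^ 2)%N)).
move: (nsq x) `|x ord0 i|%N le => n m le; congr (tau _ + tau _).
  by move: le; rewrite -!mulnn; nia.
by case: m le => [|m]; rewrite -!mulnn /=; nia.
Qed.

(** Summing the coordinate inequality makes the squares |x_i|^2 add up to |x|^2, which cancels. By
    monotonicity D may then be raised to 2d, so one radial function serves all dimensions d >=
    D/2. *)
Lemma radial_avg_le tau (D : nat) x : (0 < nsq x)%N -> (D <= 2 * d)%N ->
  tau (nsq x).+1 <= tau (nsq x) ->
  (forall m, (m ^ 2 <= nsq x)%N ->
    (nsq x)%:R * (tau ((nsq x).+1 + 2 * m)%N + tau ((nsq x).+1 - 2 * m)%N -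
                  2 * tau (nsq x).+1) <=
    D%:R * m%:R ^+ 2 * (tau (nsq x) - tau (nsq x).+1)) ->
  avg (fun y => tau (nsq y)) x <= tau (nsq x).
Proof.
move=> n0 Dd mono coord.
have d0 : 0 < 2 * d%:R :> R.
  rewrite -natrM ltr0n muln_gt0 /=; case: (posnP d) => // d0.
  by move: n0; rewrite /nsq big1// => i; have := ltn_ord i; rewrite [X in (_ < X)%N]d0.
rewrite /avg ler_pdivrMl// radial_steps.
set n := nsq x in n0 mono coord *.
have : n%:R * \sum_i (tau (n.+1 + 2 * `|x ord0 i|)%N +
    tau (n.+1 - 2 * `|x ord0 i|)%N - 2 * tau n.+1) <=
    n%:R * (D%:R * (tau n - tau n.+1)).
  rewrite mulr_sumr; apply: le_trans (ler_sum _ (fun i _ => coord _ (le_nsq x i))) _.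
  have sm : \sum_i (`|x ord0 i|%N)%:R ^+ 2 = n%:R :> R.
    by rewrite /n natr_sum; apply: eq_bigr => i _; rewrite natrX.
  by rewrite -mulr_suml -mulr_sumr sm [X in _ <= X]mulrA [X in X * _]mulrC.
rewrite ler_pM2l ?ltr0n// sumrB sumr_const card_ord => h.
have : D%:R * (tau n - tau n.+1) <= 2 * d%:R * (tau n - tau n.+1).
  by rewrite ler_wpM2r ?subr_ge0// -natrM ler_nat.
move=> h2; rewrite -mulr_natl in h; lra.
Qed.

End Radial.

(** A step decreases the Euclidean norm by at most 1: k + 1 - 2m is the squared norm after a step
    towards 0 in a coordinate of size m. *)
Lemma sub_double_ge (c k m : nat) : (c ^ 2 <= k)%N -> (m ^ 2 <= k)%N ->
  (c.-1 ^ 2 <= k.+1 - 2 * m)%N.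
Proof.
move=> ck mk; have [mc|cm] := leqP m c.
  by move: ck; rewrite -!mulnn; case: c mc => [|c] /= mc; nia.
by move: mk; rewrite -!mulnn; case: m cm => [|m] /= cm; case: c ck cm => [|c] /= ck cm; nia.
Qed.

(** * A supersolution for all dimensions d >= 4 *)

Section FourAndMore.
Context (R : realType).

(* Found by linear programming, in units of 1/500. *)
Let table : seq nat := [:: 694; 194; 124; 105; 102; 91; 86; 82; 77]%N.

Definition tau4 (k : nat) : R :=
  if (k <= 8)%N then (nth 0%N table k)%:R / 500 else tail k / 2.

Let tail_bounds k (a b : R) : 0 <= a -> 0 <= b ->
  a ^+ 2 * k.+2%:R <= 1 <= b ^+ 2 * k.+2%:R -> a <= tail k <= b.
Proof.
move=> a0 b0 /andP[ha hb]; have t0 : 0 <= tail k :> R by exact/ltW/tail_gt0.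
have k0 : 0 < k.+2%:R :> R by rewrite ltr0n.
have e : tail k ^+ 2 * k.+2%:R = 1 :> R by rewrite tail_sqr mulVf ?gt_eqF.
apply/andP; split; rewrite -ler_sqr ?nnegrE// -(ler_pM2r k0) e; [exact: ha|exact: hb].
Qed.

Let b4 : 408 / 1000 <= (tail 4 : R) <= 409 / 1000.
Proof. by apply: tail_bounds; lra. Qed.

Let b5 : 377 / 1000 <= (tail 5 : R) <= 378 / 1000.
Proof. by apply: tail_bounds; lra. Qed.

Let b6 : 353 / 1000 <= (tail 6 : R) <= 354 / 1000.
Proof. by apply: tail_bounds; lra. Qed.

Let b7 : 333 / 1000 <= (tail 7 : R) <= 334 / 1000.
Proof. by apply: tail_bounds; lra. Qed.

Let b8 : 316 / 1000 <= (tail 8 : R) <= 317 / 1000.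
Proof. by apply: tail_bounds; lra. Qed.

Let b9 : 301 / 1000 <= (tail 9 : R) <= 302 / 1000.
Proof. by apply: tail_bounds; lra. Qed.

Let b10 : 288 / 1000 <= (tail 10 : R) <= 289 / 1000.
Proof. by apply: tail_bounds; lra. Qed.

Let b11 : 277 / 1000 <= (tail 11 : R) <= 278 / 1000.
Proof. by apply: tail_bounds; lra. Qed.

Let b12 : 267 / 1000 <= (tail 12 : R) <= 268 / 1000.
Proof. by apply: tail_bounds; lra. Qed.

Let b13 : 258 / 1000 <= (tail 13 : R) <= 259 / 1000.
Proof. by apply: tail_bounds; lra. Qed.

(** The gluing condition: at points with |x|^2 >= 9 all neighbours have |y|^2 >= 4, and replacing
    their values by the tail only increases the average. *)
Let tau4_le_tail k : (4 <= k)%N -> tau4 k <= tail k / 2.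
Proof.
rewrite /tau4; case: ifP => // k8 k4.
have := (b4, b5, b6, b7, b8).
by case: k k4 k8 => [|[|[|[|[|[|[|[|[|k]]]]]]]]] //= _ _ [[[[]]]]; lra.
Qed.

Lemma tau4_mono k : tau4 k.+1 <= tau4 k.
Proof.
have := b9; rewrite /tau4; case: k => [|[|[|[|[|[|[|[|[|k]]]]]]]]] /=; try by lra.
by move=> _; rewrite ler_pM2r// tail_le.
Qed.

Lemma tau4_ge0 k : 0 <= tau4 k.
Proof.
rewrite /tau4; case: ifP => _; apply: divr_ge0;
  by rewrite ?ler0n ?(ltW (tail_gt0 _)).
Qed.

(** For k <= 8 there are finitely many cases with m <= 2. Beyond, [tail_coord] gives the stronger
    factor 6. *)
Let tau4_coord k m : (0 < k)%N -> (m ^ 2 <= k)%N ->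
  k%:R * (tau4 (k.+1 + 2 * m)%N + tau4 (k.+1 - 2 * m)%N - 2 * tau4 k.+1) <=
  8%:R * m%:R ^+ 2 * (tau4 k - tau4 k.+1).
Proof.
move=> k0 mk; case: m => [|m] in mk *.
  by rewrite muln0 addn0 subn0 expr2 !mulr0 mul0r; lra.
have [k8|k8] := leqP k 8.
  have m2 : (m < 2)%N 
    by rewrite -ltnS -(ltn_exp2r _ _ (isT : (0 < 2)%N)) (leq_ltn_trans mk)// ltnS.
  have := (b9, b10, b11, b12, b13).
  case: k k0 mk k8 => [|[|[|[|[|[|[|[|[|k]]]]]]]]] //= _;
    case: m m2 => [|[|m]] //; rewrite /tau4 /= => _ _ _ [[[[]]]]; lra.
have t1 : tau4 (k.+1 + 2 * m.+1)%N <= tail (k.+1 + 2 * m.+1)%N / 2.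
  by apply: tau4_le_tail; rewrite (leq_trans _ (leq_addr _ _))// (leq_trans _ (leqW k8)).
have t2 : tau4 (k.+1 - 2 * m.+1)%N <= tail (k.+1 - 2 * m.+1)%N / 2.
  by apply: tau4_le_tail; exact: (@sub_double_ge 3).
have e1 : tau4 k.+1 = tail k.+1 / 2 by rewrite /tau4 leqNgt ltnW.
have e2 : tau4 k = tail k / 2 by rewrite /tau4 leqNgt k8.
have := @tail_coord R k m.+1 k8 mk; rewrite e1 e2.
have d0 : 0 <= m.+1%:R ^+ 2 * (tail k - tail k.+1) :> R.
  by rewrite mulr_ge0 ?exprn_ge0// subr_ge0 tail_le.
have : k%:R * (tau4 (k.+1 + 2 * m.+1)%N + tau4 (k.+1 - 2 * m.+1)%N) <=
  k%:R * (tail (k.+1 + 2 * m.+1)%N / 2 + tail (k.+1 - 2 * m.+1)%N / 2) :> R.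
  by rewrite ler_wpM2l// lerD.
move: (tail (k.+1 + 2 * m.+1)%N) (tail (k.+1 - 2 * m.+1)%N) => a b.
move: (tau4 _) (tau4 _) => a' b'; lra.
Qed.

Lemma tau4_super d : (4 <= d)%N ->
  supersolution (fun x : 'rV[int]_d => tau4 (nsq x)).
Proof.
move=> d4; split => x; first exact: tau4_ge0.
have [->|x0] := eqVneq x 0.
  rewrite /avg radial_steps (_ : nsq 0 = 0%N); last first.
    by rewrite /nsq big1// => i _; rewrite mxE.
  under eq_bigr => i _ do rewrite mxE muln0 addn0 subn0.
  rewrite sumr_const card_ord -[X in _ * X]mulr_natl mulrDr.
  have dn : d%:R != 0 :> R by rewrite pnatr_eq0; case: (d) d4.
  have -> : (2 * d%:R)^-1 * (d%:R * tau4 1 + d%:R * tau4 1) = tau4 1.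
    by field.
  by rewrite /tau4 /=; lra.
rewrite add0r; apply: (@radial_avg_le _ _ tau4 8); rewrite ?nsq_gt0//.
- by rewrite (leq_mul2l 2 4).
- exact: tau4_mono.
- by move=> m; apply: tau4_coord; rewrite nsq_gt0.
Qed.

End FourAndMore.

(** * Numerical bounds in dimension three *)

Section Box.
Context (R : realType) (d : nat).

Definition box (r : nat) : seq 'rV[int]_d :=
  undup [seq \row_i ((f i : nat)%:Z - r%:Z) | f : {ffun 'I_d -> 'I_(2 * r).+1}].

Lemma mem_box r (x : 'rV[int]_d) :
  (forall i, (`|x ord0 i| <= r)%N) -> x \in box r.
Proof.
move=> xr; rewrite mem_undup; apply/mapP.
exists [ffun i => inord `|(x ord0 i + r%:Z)%R|%N]; first by rewrite mem_enum.
apply/rowP => i; rewrite mxE ffunE.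
have := xr i; rewrite -[x 0 i]/(x ord0 i); move: (x ord0 i) => a ar.
by rewrite inordK; lia.
Qed.

(** Since g(0) >= 1 and g >= 0, the charge max(M, 0) at every point of the box has a potential that
    is at least M on the box and nonnegative outside, where f <= 0. This dominates f as
    [sub_le_potential] requires. *)
Lemma green_ge_sub r (M : R) (f : 'rV[int]_d -> R) x :
  (exists h : 'rV[int]_d -> R, supersolution h) -> (forall y, f y <= M) ->
  (forall (y : 'rV_d) i, (r < `|y ord0 i|)%N -> f y <= 0) ->
  (forall y, f y <= (y == 0)%:R + avg f y) -> f x <= green R x.
Proof.
move=> tr fM f0 fS.
have -> : green R x = potential [:: 0] (fun=> 1) x.
  by rewrite /potential big_seq1 subr0 mul1r.
have M0 : 0 <= Num.max M 0 by rewrite le_max lexx orbT.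
apply: (@sub_le_potential _ _ tr [:: 0] (box r) _ (fun=> Num.max M 0)) => //.
- exact: undup_uniq.
- move=> y; have [yb|yb] := boolP (y \in box r).
    rewrite /potential (bigD1_seq y)//= ?undup_uniq// subrr.
    apply: (@le_trans _ _ (Num.max M 0)); first by rewrite le_max fM.
    rewrite -[leLHS]addr0 lerD//; first by rewrite ler_peMr ?green_gt0.
    by apply: sumr_ge0 => z _; rewrite mulr_ge0 ?green_ge0.
  apply: (@le_trans _ _ 0); last first.
    by apply: sumr_ge0 => z _; rewrite mulr_ge0 ?green_ge0.
  have /existsP[i] : [exists i, (r < `|y ord0 i|)%N].
    apply: contraNT yb; rewrite negb_exists => /forallP h.
    by apply: mem_box => i; rewrite leqNgt h.
  exact: f0.
- by move=> y; rewrite mulr1 inE.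
Qed.

End Box.

(** * Functions of the absolute coordinates in dimension three, with integer tables *)

Section Three.
Context (R : realType).
Local Notation pt := 'rV[int]_3.

Definition abs_fun (F : nat -> nat -> nat -> R) (x : pt) : R :=
  F `|x ord0 0%R|%N `|x ord0 1%R|%N `|x ord0 2%:R|%N.

Lemma avg_abs_fun F (x : pt) (a := `|x ord0 0%R|%N) (b := `|x ord0 1%R|%N)
    (c := `|x ord0 2%:R|%N) :
  avg (abs_fun F) x = 6^-1 * (F a.+1 b c + F (down a) b c +
    (F a b.+1 c + F a (down b) c) + (F a b c.+1 + F a b (down c))).
Proof.
rewrite /avg sum_steps !big_ord_recl big_ord0 addr0 -natrM.
have e1 : lift ord0 ord0 = 1 :> 'I_3 by apply/val_inj.
have e2 : lift ord0 (lift ord0 ord0) = 2%:R :> 'I_3 by apply/val_inj.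
rewrite e1 e2 /abs_fun !mxE /= ?mulr0 ?mulr1 ?oppr0 ?addr0.
rewrite (absz_steps (fun u => F u b c)) (absz_steps (fun u => F a u c)).
by rewrite (absz_steps (fun u => F a b u)) addrA.
Qed.

Lemma nsq3 (x : pt) :
  nsq x = (`|x ord0 0%R| ^ 2 + `|x ord0 1%R| ^ 2 + `|x ord0 2%:R| ^ 2)%N.
Proof.
rewrite /nsq !big_ord_recl big_ord0 addn0 addnA.
by congr (_ + _ ^ 2 + _ ^ 2)%N; congr (absz (x _ _)); apply/val_inj.
Qed.

Lemma norm1_3 (x : pt) :
  norm1 x = (`|x ord0 0%R| + `|x ord0 1%R| + `|x ord0 2%:R|)%N.
Proof.
rewrite /norm1 !big_ord_recl big_ord0 addn0 addnA.
by congr (_ + _ + _)%N; congr (absz (x _ _)); apply/val_inj.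
Qed.

Lemma row3_eq0 (x : pt) : (x == 0) =
  (`|x ord0 0%R| + `|x ord0 1%R| + `|x ord0 2%:R| == 0)%N.
Proof.
rewrite -norm1_3 /norm1 sum_nat_eq0; apply/eqP/forallP => [-> i|h].
  by rewrite mxE.
by apply/rowP => i; have := h i; rewrite /= absz_eq0 mxE => /eqP.
Qed.

End Three.

(* Values at the sorted absolute values a >= b >= c of the coordinates. *)
Definition sorted_lookup (T : seq (seq (seq N))) (a b c : nat) : N :=
  let hi := maxn a (maxn b c) in let lo := minn a (minn b c) in
  nth 0%num (nth [::] (nth [::] T hi) (a + b + c - hi - lo)) lo.

Definition sq3 (a b c : nat) : nat := (a ^ 2 + b ^ 2 + c ^ 2)%N.

Definition all_below (r : nat) (p : nat -> nat -> nat -> bool) : bool :=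
  all (fun a => all (fun b => all (p a b) (iota 0 r)) (iota 0 r)) (iota 0 r).

Lemma all_belowP r p a b c : all_below r p ->
  (a < r)%N -> (b < r)%N -> (c < r)%N -> p a b c.
Proof.
have m k : (k < r)%N -> k \in iota 0 r by rewrite mem_iota.
by move=> /allP pa /m/pa/allP pb /m/pb/allP pc /m/pc.
Qed.

Definition neighbor_sum (F : nat -> nat -> nat -> N) (a b c : nat) : N :=
  (F a.+1 b c + F (down a) b c + (F a b.+1 c + F a (down b) c) +
   (F a b c.+1 + F a b (down c)))%num.

Definition source (w : N) (a b c : nat) : N :=
  if (a + b + c == 0)%N then w else 0%num.

(* The first table was found by linear programming; in units of 1/10^6, it is
   continued by 0.549066/sqrt(|x|^2 + 2) for |x|^2 > 36. The second one, in units
   of 1/10^5, lies slightly below the Green function of the walk killed on leaving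
   the ball |x|^2 <= 81. *)
Definition upper_table : seq (seq (seq N)) :=
(  [:: [:: [:: 1525620]];
   [:: [:: 525618]; [:: 340380; 270701]];
   [:: [:: 266560]; [:: 224815; 201019]; [:: 177556; 166183; 145152]];
   [:: [:: 174473]; [:: 162345; 153408]; [:: 141666; 136171; 124117]; [::
    121506; 118255; 110392; 100630]];
   [:: [:: 130884]; [:: 126292; 122385]; [:: 116236; 113389; 106410]; [::
    104592; 102640; 97613; 90863]; [:: 93492; 92147; 88549]];
   [:: [:: 105658]; [:: 103503; 101531]; [:: 98078; 96484; 92329]; [::
    91028; 89834]];
   [:: [:: 89039]]])%num.

Definition lower_table : seq (seq (seq N)) :=
(  [:: [:: [:: 146435]];
   [:: [:: 46436]; [:: 27913; 20946]];
   [:: [:: 20533]; [:: 16360; 13981]; [:: 11637; 10501; 8399]];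
   [:: [:: 11331]; [:: 10120; 9226]; [:: 8054; 7505; 6300]; [:: 6044; 5718;
    4931; 3957]];
   [:: [:: 6983]; [:: 6525; 6134]; [:: 5521; 5236; 4537]; [:: 4362; 4165;
    3658; 2985]; [:: 3258; 3125; 2766; 2270; 1719]];
   [:: [:: 4476]; [:: 4261; 4063]; [:: 3721; 3561; 3138]; [:: 3023; 2900;
    2567; 2103]; [:: 2291; 2200; 1947; 1585; 1170]; [:: 1596; 1530; 1343;
    1062; 736; 367]];
   [:: [:: 2838]; [:: 2721; 2610]; [:: 2408; 2310; 2043]; [:: 1971; 1889;
    1663; 1336]; [:: 1477; 1412; 1228; 964; 665]; [:: 969; 924; 788; 564;
    327]; [:: 472; 449; 378; 250]];
   [:: [:: 1674]; [:: 1605; 1539]; [:: 1419; 1357; 1182]; [:: 1145; 1087;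
    917; 665]; [:: 811; 760; 601; 412; 247]; [:: 429; 401; 297]];
   [:: [:: 795]; [:: 742; 707]; [:: 646; 611; 504]; [:: 501; 460; 312]; [::
    302; 253]];
   [:: [:: 131]]])%num.

Definition tail_const : N := 549066%num.

(** The tail is rounded up to an integer; an overestimate is harmless because tail values occur only
    in the averages. *)
Definition upper_approx (a b c : nat) : N :=
  let n := sq3 a b c in
  if (n <= 36)%N then sorted_lookup upper_table a b c
  else (N.sqrt (tail_const ^ 2 / N.of_nat n.+2) + 1)%num.

Definition lower_value (a b c : nat) : N :=
  if (sq3 a b c <= 81)%N then sorted_lookup lower_table a b c else 0%num.

(** Coordinates up to 7 cover all neighbours of points with |x|^2 <= 36. *)
Lemma upper_tail_check : all_below 8 (fun a b c => (36 < sq3 a b c)%N ==>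
  N.leb (tail_const ^ 2) (upper_approx a b c ^ 2 * N.of_nat (sq3 a b c).+2)).
Proof. by vm_compute. Qed.

(** In the shell reached by one step from |x|^2 > 36 the table lies below the tail. *)
Lemma upper_glue_check : all_below 7 (fun a b c => (25 <= sq3 a b c <= 36)%N ==>
  N.leb (sorted_lookup upper_table a b c ^ 2 * N.of_nat (sq3 a b c).+2)
        (tail_const ^ 2)).
Proof. by vm_compute. Qed.

(** The inequality 1_0 + Ph <= h multiplied by 6 and by the scale 10^6. *)
Lemma upper_super_check : all_below 7 (fun a b c => (sq3 a b c <= 36)%N ==>
  N.leb (source 6000000 a b c + neighbor_sum upper_approx a b c)
        (6 * upper_approx a b c)).
Proof. by vm_compute. Qed.

Lemma upper_bound_check : all_below 7 (fun a b c => (sq3 a b c <= 36)%N ==>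
  [&& N.leb (upper_approx a b c) (1526 * 1000),
      (2 <= a + b + c)%N ==> N.leb (upper_approx a b c) (341 * 1000) &
      (3 <= a + b + c)%N ==> N.leb (upper_approx a b c) (271 * 1000)]).
Proof. by vm_compute. Qed.

(** The inequality f <= 1_0 + Pf multiplied by 6 and by 10^5. Beyond coordinate 9 the function is 0
    and its average is nonnegative. *)
Lemma lower_sub_check : all_below 10 (fun a b c =>
  N.leb (6 * lower_value a b c)
        (source 600000 a b c + neighbor_sum lower_value a b c)).
Proof. by vm_compute. Qed.

Lemma lower_bound_check : all_below 10 (fun a b c =>
  [&& N.leb (lower_value a b c) 1000000,
      (a + b + c == 0)%N ==> N.leb (1464 * 100) (lower_value a b c) &
      (a + b + c == 2)%N ==> N.leb (205 * 100) (lower_value a b c)]).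
Proof. by vm_compute. Qed.

Lemma le_avg_near (R : realType) d (f h : 'rV[int]_d -> R) x :
  (forall s, f (x + unit_step s) <= h (x + unit_step s)) -> avg f x <= avg h x.
Proof.
move=> le; rewrite ler_wpM2l ?invr_ge0 ?mulr_ge0 ?ler0n//.
by apply: ler_sum => s _; exact: le.
Qed.

Lemma nsq_step_ge d c (x : 'rV[int]_d) s :
  (c ^ 2 <= nsq x)%N -> (c.-1 ^ 2 <= nsq (x + unit_step s))%N.
Proof.
move=> cx; rewrite /unit_step nsq_shift; have := le_nsq x s.2.
have : (`|x ord0 s.2|.-1 <= `|(x ord0 s.2 + (-1) ^+ s.1)%R|)%N.
  by case: s.1; rewrite ?expr1 ?expr0; lia.
move: (nsq x) `|x ord0 s.2|%N `|(x ord0 s.2 + (-1) ^+ s.1)%R|%N cx => n m u cx um mn.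
case: m um mn => [|m] /= um mn.
  rewrite exp0n// subn0 (leq_trans _ (leq_addr _ _))// (leq_trans _ cx)//.
  by rewrite leq_exp2r ?leq_pred.
apply: leq_trans (sub_double_ge cx mn) _.
have : (m ^ 2 <= u ^ 2)%N by rewrite leq_exp2r.
by move: mn; rewrite -!mulnn; nia.
Qed.

(** * From the integer checks to bounds on g in dimension three *)

Section ThreeNumerics.
Context (R : realType).
Local Notation pt := 'rV[int]_3.

Definition NR (n : N) : R := (N.to_nat n)%:R.

Lemma NR_D m n : NR (m + n) = NR m + NR n.
Proof. by rewrite /NR N2Nat.inj_add plusE natrD. Qed.

Lemma NR_M m n : NR (m * n) = NR m * NR n.
Proof. by rewrite /NR N2Nat.inj_mul multE natrM. Qed.

Lemma NR_sqr m : NR (m ^ 2) = NR m ^+ 2.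
Proof. by rewrite N.pow_2_r NR_M expr2. Qed.

Lemma NR_le m n : N.leb m n -> NR m <= NR n.
Proof.
by move=> /N.leb_spec0/N.sub_add <-; rewrite NR_D lerDr ler0n.
Qed.

Lemma NR_nat n : NR (N.of_nat n) = n%:R.
Proof. by rewrite /NR Nat2N.id. Qed.

Lemma NR_ge0 n : 0 <= NR n.
Proof. exact: ler0n. Qed.

Lemma NR1000 : NR 1000 = 1000.
Proof. by rewrite /NR (_ : N.to_nat 1000 = 1000%N). Qed.

Lemma NR6 : NR 6 = 6.
Proof. by []. Qed.

Definition upper_fun (a b c : nat) : R :=
  if (sq3 a b c <= 36)%N then NR (sorted_lookup upper_table a b c)
  else NR tail_const * tail (sq3 a b c).

Let tail_le_N n u : N.leb (tail_const ^ 2) (u ^ 2 * N.of_nat n.+2) ->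
  NR tail_const * tail n <= NR u.
Proof.
move=> /NR_le; rewrite NR_M !NR_sqr NR_nat => h.
have t0 : 0 <= tail n :> R by exact/ltW/tail_gt0.
rewrite -ler_sqr ?nnegrE ?mulr_ge0 ?NR_ge0// exprMn tail_sqr.
by rewrite ler_pdivrMr// ltr0n.
Qed.

Let N_le_tail n u : N.leb (u ^ 2 * N.of_nat n.+2) (tail_const ^ 2) ->
  NR u <= NR tail_const * tail n.
Proof.
move=> /NR_le; rewrite NR_M !NR_sqr NR_nat => h.
have t0 : 0 <= tail n :> R by exact/ltW/tail_gt0.
rewrite -ler_sqr ?nnegrE ?mulr_ge0 ?NR_ge0// exprMn tail_sqr.
by rewrite ler_pdivlMr// ltr0n.
Qed.

Let upper_le_approx a b c : (a < 8)%N -> (b < 8)%N -> (c < 8)%N ->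
  upper_fun a b c <= NR (upper_approx a b c).
Proof.
move=> a8 b8 c8; have := all_belowP upper_tail_check a8 b8 c8.
rewrite /upper_fun; case: leqP => n36 /=; first by rewrite /upper_approx n36.
exact: tail_le_N.
Qed.

Let sq3_lt a b c r : (sq3 a b c <= r ^ 2)%N ->
  [/\ (a < r.+1)%N, (b < r.+1)%N & (c < r.+1)%N].
Proof.
rewrite /sq3 => h.
have le m : (m ^ 2 <= a ^ 2 + b ^ 2 + c ^ 2)%N -> (m < r.+1)%N.
  by move=> mh; rewrite ltnS -(@leq_exp2r _ _ 2)// (leq_trans mh).
by split; apply: le; rewrite ?leq_addl// -addnA ?leq_addr// addnCA leq_addr.
Qed.

Let NR_source (k : N) a b c :
  NR (source k a b c) = (a + b + c == 0)%N%:R * NR k.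
Proof. by rewrite /source; case: eqP; rewrite ?mul1r ?mul0r. Qed.

Let NR_neighbor_sum F a b c : NR (neighbor_sum F a b c) =
  NR (F a.+1 b c) + NR (F (down a) b c) + (NR (F a b.+1 c) + NR (F a (down b) c)) +
  (NR (F a b c.+1) + NR (F a b (down c))).
Proof. by rewrite /neighbor_sum !NR_D. Qed.

Let down_lt m r : (m < r.+1)%N -> (down m < r.+2)%N.
Proof. by case: m => // m mr; exact: leqW (ltnW mr). Qed.

Let unit_up : NR 6000000 = 6 * 1000 ^+ 2.
Proof. by rewrite (_ : 6000000%num = (6 * (1000 * 1000))%num)// !NR_M NR1000 expr2. Qed.

Let unit_low : NR 600000 = 6 * (1000 * 100).
Proof.
by rewrite (_ : 600000%num = (6 * (1000 * 100))%num)// !NR_M NR1000.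
Qed.

Let nsq_sq3 (x : pt) :
  nsq x = sq3 `|x ord0 0%R|%N `|x ord0 1%R|%N `|x ord0 2%:R|%N.
Proof. exact: nsq3. Qed.

Definition upper_sol (x : pt) : R := (1000 ^+ 2)^-1 * abs_fun upper_fun x.

Let upper_far_super (x : pt) : (36 < nsq x)%N ->
  avg (abs_fun upper_fun) x <= abs_fun upper_fun x.
Proof.
move=> n36; have -> : abs_fun upper_fun x = NR tail_const * tail (nsq x).
  by rewrite /abs_fun /upper_fun -nsq_sq3 leqNgt n36.
have n0 : (0 < nsq x)%N by exact: leq_trans n36.
apply: (@le_trans _ _ (avg (fun y => NR tail_const * tail (nsq y)) x)).
  apply: le_avg_near => s; rewrite /abs_fun /upper_fun -nsq_sq3.
  case: leqP => // ns36; set a := absz _; set b := absz _; set c := absz _.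
  (* One step from |x| >= 6 leads to |y| >= 5, inside the range of the gluing check. *)
  have n25 := nsq_step_ge (c := 6) s (ltnW n36).
  apply: N_le_tail; rewrite nsq_sq3 -/a -/b -/c.
  rewrite nsq_sq3 -/a -/b -/c in ns36 n25.
  have [a7 b7 c7] := sq3_lt (r := 6) ns36.
  by have := all_belowP upper_glue_check a7 b7 c7; rewrite ns36 n25.
rewrite avgZ ler_wpM2l ?NR_ge0//.
apply: (@radial_avg_le _ _ (@tail R) 6) => //; first exact: tail_le.
by move=> m; apply: tail_coord; exact: leq_trans n36.
Qed.

Lemma upper_sol_super : supersolution upper_sol.
Proof.
rewrite /upper_sol; have : 0 < 1000 ^+ 2 :> R by rewrite exprn_gt0 ?ltr0n.
have := unit_up; set K : R := 1000 ^+ 2; move: K => K unitK K0.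
split => x.
  apply: mulr_ge0; first by rewrite invr_ge0 ltW.
  rewrite /abs_fun /upper_fun; case: ifP => _; first exact: NR_ge0.
  by rewrite mulr_ge0 ?NR_ge0// ltW// tail_gt0.
rewrite avgZ.
rewrite -[(x == 0)%:R](mulKf (lt0r_neq0 K0)) -mulrDr ler_wpM2l ?invr_ge0 ?(ltW K0)//.
have [n36|n36] := leqP (nsq x) 36; last first.
  have -> : x == 0 = false.
    by apply: contraTF n36 => /eqP->; rewrite /nsq big1// => i _; rewrite mxE.
  by rewrite mulr0 add0r; exact: upper_far_super.
rewrite avg_abs_fun row3_eq0 /abs_fun; rewrite nsq_sq3 in n36.
move: `|x ord0 0%R|%N `|x ord0 1%R|%N `|x ord0 2%:R|%N n36 => a b c n36.
have [a7 b7 c7] := sq3_lt (r := 6) n36.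
have := all_belowP upper_super_check a7 b7 c7; rewrite n36 => /NR_le.
rewrite NR_D NR_M NR_source NR_neighbor_sum unitK.
have -> : NR (upper_approx a b c) = upper_fun a b c.
  by rewrite /upper_approx /upper_fun n36.
have lt8 k : (k < 7)%N -> (k < 8)%N by apply: ltnW.
have h1 := upper_le_approx (a7 : (a.+1 < 8)%N) (lt8 _ b7) (lt8 _ c7).
have h2 := upper_le_approx (down_lt a7) (lt8 _ b7) (lt8 _ c7).
have h3 := upper_le_approx (lt8 _ a7) (b7 : (b.+1 < 8)%N) (lt8 _ c7).
have h4 := upper_le_approx (lt8 _ a7) (down_lt b7) (lt8 _ c7).
have h5 := upper_le_approx (lt8 _ a7) (lt8 _ b7) (c7 : (c.+1 < 8)%N).
have h6 := upper_le_approx (lt8 _ a7) (lt8 _ b7) (down_lt c7).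
by rewrite NR6; move: h1 h2 h3 h4 h5 h6; lra.
Qed.

Let NR_units v k (c : R) : NR k = c -> N.leb v (k * 1000) ->
  (1000 ^+ 2)^-1 * NR v <= c / 1000.
Proof.
move=> kc /NR_le; rewrite NR_M kc NR1000 => h.
have K0 : 0 < 1000 :> R by rewrite ltr0n.
rewrite expr2 invfM -mulrA mulrC ler_pM2r ?invr_gt0//.
by rewrite mulrC ler_pdivrMr.
Qed.

Let NR1526 : NR 1526 = 1526.
Proof. by rewrite /NR (_ : N.to_nat 1526 = 1526%N). Qed.

Let NR341 : NR 341 = 341.
Proof. by rewrite /NR (_ : N.to_nat 341 = 341%N). Qed.

Let NR271 : NR 271 = 271.
Proof. by rewrite /NR (_ : N.to_nat 271 = 271%N). Qed.

Let NR600 : NR 600 = 600.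
Proof. by rewrite /NR (_ : N.to_nat 600 = 600%N). Qed.

Let upper_far_le x : (36 < nsq x)%N -> upper_sol x <= 100 / 1000.
Proof.
move=> n36; rewrite /upper_sol /abs_fun /upper_fun -nsq_sq3 leqNgt n36 /= mulrA.
have t6 : tail (nsq x) <= 6^-1 :> R.
  rewrite -ler_sqr ?nnegrE ?invr_ge0// ?(ltW (tail_gt0 _))// tail_sqr exprVn.
  by rewrite lef_pV2 ?posrE ?ltr0n// -natrX ler_nat; exact: leqW (leqW (ltnW n36)).
have c6 : (1000 ^+ 2)^-1 * NR tail_const <= 600 / 1000 by exact: NR_units NR600 _.
apply: le_trans (ler_pM _ _ c6 t6) _.
- apply: mulr_ge0; last exact: NR_ge0.
  rewrite invr_ge0; apply: exprn_ge0; exact: ler0n.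
- exact/ltW/tail_gt0.
- by lra.
Qed.

Lemma upper_sol_bounds x :
  [/\ upper_sol x <= 1526 / 1000,
      (2 <= norm1 x)%N -> upper_sol x <= 341 / 1000 &
      (3 <= norm1 x)%N -> upper_sol x <= 271 / 1000].
Proof.
have [n36|n36] := leqP (nsq x) 36; last first.
  by have := upper_far_le n36; split; lra.
rewrite /upper_sol /abs_fun norm1_3; rewrite nsq_sq3 in n36.
move: `|x ord0 0%R|%N `|x ord0 1%R|%N `|x ord0 2%:R|%N n36 => a b c n36.
have [a7 b7 c7] := sq3_lt (r := 6) n36.
have := all_belowP upper_bound_check a7 b7 c7; rewrite n36 /=.
rewrite /upper_fun /upper_approx n36 => /and3P[h1 /implyP h2 /implyP h3].
split=> [|/h2{}h2|/h3{}h3].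
- exact: NR_units NR1526 h1.
- exact: NR_units NR341 h2.
- exact: NR_units NR271 h3.
Qed.

Definition lower_sol (x : pt) : R :=
  (1000 * 100)^-1 * abs_fun (fun a b c => NR (lower_value a b c)) x.

Let lower_far a b c : (9 < a)%N || (9 < b)%N || (9 < c)%N -> lower_value a b c = 0%num.
Proof.
move=> far; rewrite /lower_value; case: ifP => // n81; move: far.
have [a10 b10 c10] := sq3_lt (r := 9) n81.
by rewrite !ltnNge -(ltnS a) a10 -(ltnS b) b10 -(ltnS c) c10.
Qed.

Lemma lower_sol_sub x : lower_sol x <= (x == 0)%:R + avg lower_sol x.
Proof.
rewrite /lower_sol avgZ; have : 0 < 1000 * 100 :> R by rewrite -natrM ltr0n.
have := unit_low; set K : R := 1000 * 100; move: K => K unitK K0.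
rewrite -[(x == 0)%:R](mulKf (lt0r_neq0 K0)) -mulrDr ler_wpM2l ?invr_ge0 ?(ltW K0)//.
rewrite avg_abs_fun row3_eq0 /abs_fun.
move: `|x ord0 0%R|%N `|x ord0 1%R|%N `|x ord0 2%:R|%N => a b c.
have [far|] := boolP ((9 < a)%N || (9 < b)%N || (9 < c)%N).
  rewrite lower_far// addr_ge0 ?mulr_ge0 ?ler0n ?(ltW K0)// ?invr_ge0 ?ler0n//.
  by rewrite !addr_ge0 ?NR_ge0.
rewrite !negb_or -!leqNgt => /andP[/andP[a9 b9] c9].
have := all_belowP lower_sub_check (a9 : (a < 10)%N) (b9 : (b < 10)%N) (c9 : (c < 10)%N).
move=> /NR_le; rewrite NR_D NR_M NR_source NR_neighbor_sum unitK NR6; lra.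
Qed.

Lemma lower_sol_le_green x : lower_sol x <= green R x.
Proof.
have K0 : 0 < 1000 * 100 :> R by rewrite -natrM ltr0n.
have KV0 : 0 <= (1000 * 100)^-1 :> R by rewrite invr_ge0 ltW.
apply: (@green_ge_sub _ _ 9 ((1000 * 100)^-1 * NR 1000000)).
- by exists upper_sol; exact: upper_sol_super.
- move=> y; apply: ler_wpM2l => //; rewrite /abs_fun.
  move: `|y ord0 0%R|%N `|y ord0 1%R|%N `|y ord0 2%:R|%N => a b c.
  have [far|] := boolP ((9 < a)%N || (9 < b)%N || (9 < c)%N).
    by rewrite lower_far// NR_ge0.
  rewrite !negb_or -!leqNgt => /andP[/andP[a9 b9] c9].
  have := all_belowP lower_bound_check (a9 : (a < 10)%N) (b9 : (b < 10)%N) (c9 : (c < 10)%N).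
  by case/and3P => /NR_le.
- move=> y i yi; rewrite /lower_sol /abs_fun lower_far ?mulr0//.
  have : [|| i == 0, i == 1 | i == 2%:R] by case: i {yi} => [[|[|[|]]]].
  by case/or3P => /eqP e; rewrite e in yi; rewrite yi ?orbT.
- exact: lower_sol_sub.
Qed.

Let NR_units_low v k (c : R) : NR k = c -> N.leb (k * 100) v ->
  c / 1000 <= (1000 * 100)^-1 * NR v.
Proof.
move=> kc /NR_le; rewrite NR_M kc (_ : NR 100 = 100); last first.
  by rewrite /NR (_ : N.to_nat 100 = 100%N).
move: (NR v) => w; lra.
Qed.

Lemma green3_lower : 73 / 50 <= green R (0 : pt).
Proof.
apply: (@le_trans _ _ (1464 / 1000)); first by lra.
apply: le_trans (lower_sol_le_green 0); rewrite /lower_sol /abs_fun !mxE.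
have /and3P[_ h _] := all_belowP lower_bound_check (isT : (0 < 10)%N)
  (isT : (0 < 10)%N) (isT : (0 < 10)%N).
by apply: NR_units_low h; rewrite /NR (_ : N.to_nat 1464 = 1464%N).
Qed.

Lemma green3_norm2_lower (x : pt) :
  norm1 x = 2%N -> 1 / 5 <= green R x.
Proof.
rewrite norm1_3 => x2; apply: (@le_trans _ _ (205 / 1000)); first by lra.
apply: le_trans (lower_sol_le_green x).
move: x2; rewrite /lower_sol /abs_fun.
move: `|x ord0 0%R|%N `|x ord0 1%R|%N `|x ord0 2%:R|%N => a b c abc.
have [a9 b9 c9] : [/\ (a < 10)%N, (b < 10)%N & (c < 10)%N] by split; lia.
have /and3P[_ _ /implyP h] := all_belowP lower_bound_check a9 b9 c9.
by apply: NR_units_low (h _); rewrite ?abc// /NR (_ : N.to_nat 205 = 205%N).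
Qed.

Lemma green3_upper (x : pt) :
  [/\ green R x <= 153 / 100,
      (2 <= norm1 x)%N -> green R x <= 43 / 125 &
      (3 <= norm1 x)%N -> green R x <= 34 / 125].
Proof.
have le : green R x <= upper_sol x.
  apply: green_le_super; last exact: upper_sol_super.
  by exists upper_sol; exact: upper_sol_super.
have [h1 h2 h3] := upper_sol_bounds x.
by split=> [|/h2 h|/h3 h]; apply: (le_trans le); lra.
Qed.

End ThreeNumerics.

(** * Capacities of small sets *)

Section Norm.
Context (d : nat).
Implicit Types x y z : 'rV[int]_d.

Definition parity x : bool := odd (norm1 x).

Lemma norm1D x y : (norm1 (x + y) <= norm1 x + norm1 y)%N.
Proof.
rewrite /norm1 -big_split; apply: leq_sum => i _; rewrite mxE /=.
by move: (x ord0 i) (y ord0 i) => a b; lia.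
Qed.

Lemma norm1N x : norm1 (- x) = norm1 x.
Proof. by apply: eq_bigr => i _; rewrite mxE abszN. Qed.

Lemma norm1B x y : norm1 (x - y) = norm1 (y - x).
Proof. by rewrite -opprB norm1N. Qed.

Lemma norm1_eq0 x : (norm1 x == 0)%N = (x == 0).
Proof.
rewrite /norm1 sum_nat_eq0; apply/forallP/eqP => [h|-> i].
  by apply/rowP => i; have := h i; rewrite /= absz_eq0 mxE => /eqP.
by rewrite mxE.
Qed.

Lemma parityB x y : odd (norm1 (x - y)) = parity x (+) parity y.
Proof.
rewrite /parity /norm1 !(big_morph odd oddD (erefl : odd 0 = false)) -big_split.
apply: eq_bigr => i _; rewrite !mxE; move: (x _ _) (y _ _) => a b /=; lia.
Qed.

Lemma lattice_adjE x y : lattice_adj x y = (norm1 (x - y) == 1)%N.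
Proof.
rewrite /lattice_adj -eqz_nat /norm1 (big_morph Posz PoszD (erefl _)).
by congr (_ == _); apply: eq_bigr => i _; rewrite !mxE abszE.
Qed.

Lemma lattice_adjC x y : lattice_adj x y = lattice_adj y x.
Proof. by rewrite !lattice_adjE norm1B. Qed.

Lemma lattice_adjxx x : lattice_adj x x = false.
Proof. by rewrite lattice_adjE subrr (eqP (_ : norm1 0 == 0)%N)// norm1_eq0. Qed.

Lemma lattice_adj_parity x y : lattice_adj x y -> parity x (+) parity y.
Proof. by rewrite lattice_adjE -parityB => /eqP->. Qed.

Lemma nonadj_norm1 x y : x != y -> ~~ lattice_adj x y -> (2 <= norm1 (x - y))%N.
Proof.
by rewrite -subr_eq0 -norm1_eq0 lattice_adjE; case: (norm1 _) => [|[|]].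
Qed.

Lemma nonadj_norm1_odd x y : x != y -> ~~ lattice_adj x y ->
  parity x (+) parity y -> (3 <= norm1 (x - y))%N.
Proof.
move=> xy /(nonadj_norm1 xy); rewrite -parityB.
by case: (norm1 _) => [|[|[|]]].
Qed.

(** The distance of y and z is at most 2, even by parity, and not 0. *)
Lemma common_neighbor_norm1 x y z : y != z -> lattice_adj x y ->
  lattice_adj x z -> norm1 (y - z) = 2%N.
Proof.
move=> yz xy xz; have := norm1D (y - x) (x - z).
rewrite addrA subrK.
move: xy xz (lattice_adj_parity xy) (lattice_adj_parity xz).
rewrite (lattice_adjC x y) !lattice_adjE => /eqP-> /eqP-> p1 p2.
have : ~~ odd (norm1 (y - z)) 
  by rewrite parityB; case: (parity x) (parity y) (parity z) p1 p2 => [] [] [].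
by move: yz; rewrite -subr_eq0 -norm1_eq0; case: (norm1 _) => [|[|[|]]].
Qed.

Lemma norm1_1 x : norm1 x = 1%N -> exists s, x = unit_step s.
Proof.
move=> x1; have [i xi] : exists i, x ord0 i != 0.
  apply/existsP; apply: contra_eqT x1; rewrite negb_exists => /forallP h.
  by rewrite /norm1 big1// => i _; have := h i; rewrite negbK => /eqP->.
move: x1; rewrite /norm1 (bigD1 i)//= => x1.
have xi1 : `|x ord0 i|%N = 1%N by move: xi x1; lia.
have : (\sum_(j | j != i) `|x ord0 j| == 0)%N by move: x1; rewrite xi1 add1n => -[->].
rewrite sum_nat_eq0 => /forallP h.
exists (x ord0 i == -1, i); apply/rowP => j; rewrite !mxE /=.
have [->|ji] := eqVneq j i.
  rewrite mulr1 -[x 0 i]/(x ord0 i); move: (x ord0 i) xi1 => a.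
  by case: eqP => /= [->//|]; lia.
by have := h j; rewrite ji /= mulr0 absz_eq0 => /eqP.
Qed.

End Norm.

(** * Capacities from linear systems with the Green matrix *)

Section SmallSets.
Context (R : realType) (d : nat).
Local Notation pt := 'rV[int]_d.
Local Notation G := (green R).
Implicit Types x y z : pt.
Hypothesis d_gt0 : (0 < d)%N.
Hypothesis transient : exists h : pt -> R, supersolution h.

Let g := G (0 : pt).

Lemma greenC x y : G (x - y) = G (y - x).
Proof. by rewrite -opprB green_opp. Qed.

(** Coordinate transpositions and x -> -x preserve g and act transitively on the unit steps. *)
Lemma green_unit_step (s t : bool * 'I_d) : G (unit_step s) = G (unit_step t).
Proof.
have dir (i j : 'I_d) : G (delta_mx ord0 i : pt) = G (delta_mx ord0 j : pt).
  rewrite -(green_perm R (tperm i j)); congr (G _); apply/rowP => k.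
  by rewrite !mxE (can2_eq (tpermK i j) (tpermK i j)) tpermL.
have flip (u : bool * 'I_d) : G (unit_step u) = G (delta_mx ord0 u.2 : pt).
  by rewrite /unit_step; case: u.1; rewrite ?scaleN1r ?scale1r ?green_opp.
by rewrite !flip.
Qed.

Lemma green_adj x y : lattice_adj x y -> G (x - y) = g - 1.
Proof.
rewrite lattice_adjE => /eqP/norm1_1[s ->].
rewrite /g (greenE transient 0) eqxx addrAC mulr1n subrr add0r.
rewrite -[LHS](avg_cst (G (unit_step s)) 0 d_gt0).
by rewrite /avg; congr (_ * _); apply: eq_bigr => t _; rewrite add0r (green_unit_step s t).
Qed.

Lemma escape_eq (K : seq pt) x : uniq K -> x \in K ->
  \sum_(y <- K) escape R K y * G (x - y) = 1.
Proof.
move=> uK xK; rewrite -[LHS]/(potential K (escape R K) x).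
by rewrite potential_escape// xK mul0r subr0.
Qed.

Let g1 : 1 <= g. Proof. exact: green_gt0. Qed.
Let g_gt0 : 0 < g. Proof. exact: lt_le_trans ltr01 g1. Qed.

Lemma rcap1_le x : rcap R [:: x] <= 2 / g.
Proof.
have := @escape_eq [:: x] x isT (mem_head _ _).
rewrite /rcap !big_seq1 subrr -/g ler_pdivlMr// => ->; lra.
Qed.

(** Adding the two equations gives (e(x) + e(y)) (g(0) + g(x - y)) = 2. *)
Lemma rcap2_le x y : x != y -> rcap R [:: x; y] <= 2 / g.
Proof.
move=> xy; have u : uniq [:: x; y] by rewrite /= inE xy.
have := @escape_eq [:: x; y] y u; have := @escape_eq [:: x; y] x u.
rewrite !inE !eqxx orbT => /(_ isT) + /(_ isT).
have e0 z : 0 <= escape R [:: x; y] z by exact: escape_ge0.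
rewrite /rcap !big_cons !big_nil !addr0 !subrr -/g (greenC y x) ler_pdivlMr//.
have := green_ge0 transient (x - y); have := e0 x; have := e0 y.
move: (escape _ _ x) (escape _ _ y) (G _) => a b c; nra.
Qed.

(** The Green matrix is positive semidefinite by diagonal dominance. Its form at e - t(1,1,1), with
    t = 3/S and S the sum of all entries, equals e1 + e2 + e3 - 3t, so the sum is at least 9/S; and
    S < 9h/2. *)
Lemma system3_gt (h a b c e1 e2 e3 : R) : 0 < h ->
  0 <= a -> 0 <= b -> 0 <= c -> a + b + c < 3 / 4 * h ->
  e1 * h + e2 * a + e3 * b = 1 -> e1 * a + e2 * h + e3 * c = 1 ->
  e1 * b + e2 * c + e3 * h = 1 -> 2 < (e1 + e2 + e3) * h.
Proof.
move=> h0 a0 b0 c0 abc E1 E2 E3.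
pose S := 3 * h + 2 * (a + b + c); have S0 : 0 < S by rewrite /S; lra.
pose t := 3 / S; have tS : t * S = 3 by rewrite /t divfK ?gt_eqF.
have t0 : 0 < t by rewrite divr_gt0.
pose f1 := e1 - t; pose f2 := e2 - t; pose f3 := e3 - t.
have Q0 : 0 <= a * (f1 + f2) ^+ 2 + b * (f1 + f3) ^+ 2 + c * (f2 + f3) ^+ 2 +
    ((h - a - b) * f1 ^+ 2 + (h - a - c) * f2 ^+ 2 + (h - b - c) * f3 ^+ 2).
  by rewrite !addr_ge0// mulr_ge0 ?sqr_ge0//; lra.
have QE : a * (f1 + f2) ^+ 2 + b * (f1 + f3) ^+ 2 + c * (f2 + f3) ^+ 2 +
    ((h - a - b) * f1 ^+ 2 + (h - a - c) * f2 ^+ 2 + (h - b - c) * f3 ^+ 2) =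
    e1 * (e1 * h + e2 * a + e3 * b) + e2 * (e1 * a + e2 * h + e3 * c) +
    e3 * (e1 * b + e2 * c + e3 * h) - 2 * t * ((e1 * h + e2 * a + e3 * b) +
    (e1 * a + e2 * h + e3 * c) + (e1 * b + e2 * c + e3 * h)) + t * (t * S).
  by rewrite /f1 /f2 /f3 /S; ring.
move: Q0; rewrite QE E1 E2 E3 tS => C3.
have C3' : 3 * t <= e1 + e2 + e3 by lra.
have th : 2 < 3 * t * h.
  have : 2 * S < 3 * t * h * S.
    have -> : 3 * t * h * S = 3 * h * (t * S) by ring.
    by rewrite tS /S; lra.
  by rewrite ltr_pM2r.
by apply: (lt_le_trans th); rewrite ler_pM2r.
Qed.

Let uniq3 x y z : x != y -> x != z -> y != z -> uniq [:: x; y; z].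
Proof. by move=> xy xz yz; rewrite /= !inE negb_or xy xz yz. Qed.

Let system3 x y z : x != y -> x != z -> y != z ->
  let e := escape R [:: x; y; z] in
  [/\ e x * g + e y * G (x - y) + e z * G (x - z) = 1,
      e x * G (x - y) + e y * g + e z * G (y - z) = 1,
      e x * G (x - z) + e y * G (y - z) + e z * g = 1 &
      rcap R [:: x; y; z] = e x + e y + e z].
Proof.
move=> xy xz yz; have u := uniq3 xy xz yz; split.
- rewrite -[RHS](escape_eq u (_ : x \in _)) ?inE ?eqxx//.
  by rewrite !big_cons big_nil addr0 subrr addrA.
- rewrite -[RHS](escape_eq u (_ : y \in _)) ?inE ?eqxx ?orbT//.
  by rewrite !big_cons big_nil addr0 subrr addrA (greenC y x).
- rewrite -[RHS](escape_eq u (_ : z \in _)) ?inE ?eqxx ?orbT//.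
  by rewrite !big_cons big_nil addr0 subrr addrA (greenC z x) (greenC z y).
- by rewrite /rcap !big_cons big_nil addr0 addrA.
Qed.

Lemma rcap3_gt x y z : x != y -> x != z -> y != z ->
  G (x - y) + G (x - z) + G (y - z) < 3 / 4 * g -> 2 / g < rcap R [:: x; y; z].
Proof.
move=> xy xz yz S; have [E1 E2 E3 ->] := system3 xy xz yz.
rewrite ltr_pdivrMr//.
exact: (system3_gt g_gt0 (green_ge0 transient _) (green_ge0 transient _)
  (green_ge0 transient _) S E1 E2 E3).
Qed.

(** The first equation, that of the centre, gives (e1 + e2 + e3) h = 1 + (e2 + e3), so the claim is
    e2 + e3 <= 1. Eliminating e1 gives (e2 + e3) (h(h + b) - 2(h - 1)^2) = 2, and the second factor
    is at least 2 exactly when (2 - h)^2 <= hb. *)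
Lemma system_path_le (h a b e1 e2 e3 : R) : 0 < h -> a = h - 1 -> 0 <= b ->
  0 <= e1 -> 0 <= e2 -> 0 <= e3 ->
  (2 - h) ^+ 2 <= h * b ->
  e1 * h + e2 * a + e3 * a = 1 -> e1 * a + e2 * h + e3 * b = 1 ->
  e1 * a + e2 * b + e3 * h = 1 -> (e1 + e2 + e3) * h <= 2.
Proof.
move=> h0 -> b0 p1 p2 p3 hb E1 E2 E3.
have e : (e1 + e2 + e3) * h = 1 + (e2 + e3) by nra.
rewrite e; suff : e2 + e3 <= 1 by lra.
have D : (e2 + e3) * (h * (h + b) - 2 * (h - 1) ^+ 2) = 2.
  have E : 2 * (h - 1) * e1 + (h + b) * (e2 + e3) = 2 by lra.
  have E' : e1 * h = 1 - (h - 1) * (e2 + e3) by lra.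
  have : h * (2 * (h - 1) * e1 + (h + b) * (e2 + e3)) = 2 * h by rewrite E; ring.
  have -> : h * (2 * (h - 1) * e1 + (h + b) * (e2 + e3)) =
    2 * (h - 1) * (e1 * h) + h * (h + b) * (e2 + e3) by ring.
  by rewrite E'; lra.
have : 2 <= h * (h + b) - 2 * (h - 1) ^+ 2 by move: hb; rewrite !expr2; lra.
move: D; set q := h * _ - _ => D q2.
have s0 : 0 <= e2 + e3 by rewrite addr_ge0.
nra.
Qed.

Lemma rcap_path_le x y z : x != y -> x != z -> y != z ->
  (lattice_adj x y && lattice_adj x z) || (lattice_adj x y && lattice_adj y z) ||
  (lattice_adj x z && lattice_adj y z) ->
  (forall u : pt, norm1 u = 2%N -> (2 - g) ^+ 2 <= g * G u) ->
  rcap R [:: x; y; z] <= 2 / g.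
Proof.
move=> xy xz yz adj b2; have [E1 E2 E3 ->] := system3 xy xz yz.
have e0 u : 0 <= escape R [:: x; y; z] u by exact: escape_ge0.
move: (e0 x) (e0 y) (e0 z) E1 E2 E3.
move: (escape _ _ x) (escape _ _ y) (escape _ _ z) => ex ey ez px py pz.
rewrite ler_pdivlMr//.
have G0 := green_ge0 transient.
case/orP: adj => [/orP[]|] /andP[A B].
- rewrite (green_adj A) (green_adj B) => E1 E2 E3.
  have n := common_neighbor_norm1 yz A B.
  exact: (system_path_le g_gt0 erefl (G0 _) px py pz (b2 _ n) E1 E2 E3).
- rewrite (green_adj A) (green_adj B) => E1 E2 E3.
  rewrite lattice_adjC in A; have n := common_neighbor_norm1 xz A B.
  rewrite [ex + ey]addrC.
  by apply: (system_path_le g_gt0 erefl (G0 _) py px pz (b2 _ n)); lra.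
- rewrite (green_adj A) (green_adj B) => E1 E2 E3.
  rewrite lattice_adjC in A; rewrite lattice_adjC in B.
  have n := common_neighbor_norm1 xy A B.
  rewrite addrC addrA.
  by apply: (system_path_le g_gt0 erefl (G0 _) pz px py (b2 _ n)); lra.
Qed.

(** Adding the equations of all points of K expresses |K| as the sum of e(y) times the column sum at
    y. *)
Lemma rcap_column_gt (K : seq pt) (M : R) : uniq K -> 0 < M ->
  (forall y, y \in K -> \sum_(x <- K) G (x - y) <= M) ->
  (size K)%:R / M <= rcap R K.
Proof.
move=> uK M0 col; rewrite ler_pdivrMr//.
have -> : (size K)%:R = \sum_(x <- K) \sum_(y <- K) escape R K y * G (x - y).
  rewrite big_seq; under eq_bigr => x xK do rewrite (escape_eq uK xK).
  by rewrite -big_seq big_const_seq count_predT iter_addr_0.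
rewrite exchange_big /= /rcap mulr_suml big_seq [leRHS]big_seq.
apply: ler_sum => y yK; rewrite -mulr_sumr ler_wpM2l ?col//.
exact: escape_ge0.
Qed.

End SmallSets.

(** [tau4] gives g(0) <= 7/5 and g <= 31/125 at nonadjacent differences. By parity not all three
    pairs are adjacent; the tightest case has two, where 2(g(0) - 1) + 31/125 < 3 g(0)/4 needs g(0)
    < 1.4016. *)
Lemma high_triple_gt (R : realType) (d : nat) (x y z : 'rV[int]_d) :
  (4 <= d)%N -> x != y -> x != z -> y != z ->
  2 / green R (0 : 'rV[int]_d) < rcap R [:: x; y; z].
Proof.
move=> d4 xy xz yz; have d0 : (0 < d)%N by exact: leq_trans d4.
have super := tau4_super R d4.
have tr : exists h : 'rV[int]_d -> R, supersolution h by eexists; exact: super.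
set g := green R _; have g1 : 1 <= g := green_gt0 tr.
have g2 : g <= 7 / 5.
  apply: le_trans (green_le_super tr 0 super) _.
  by rewrite /nsq big1 => [|i _]; [rewrite /tau4 /=; lra|rewrite mxE].
have far (u v : 'rV[int]_d) : u != v -> ~~ lattice_adj u v -> green R (u - v) <= 31 / 125.
  move=> uv nadj; have n2 := nonadj_norm1 uv nadj.
  apply: le_trans (green_le_super tr (u - v) super) _.
  have : (2 <= nsq (u - v))%N.
    apply: leq_trans n2 _; apply: leq_sum => i _.
    by rewrite -mulnn; case: (absz _) => // k; exact: leq_pmulr.
  have mono i j : (i <= j)%N -> tau4 R j <= tau4 R i.
    by apply: (homo_leq (r := fun a b : R => b <= a)) => [//|a b c ba cb|k];
      [exact: le_trans cb ba|exact: tau4_mono].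
  move=> /mono/le_trans; apply; rewrite /tau4 /=; lra.
apply: (rcap3_gt d0 tr xy xz yz); rewrite -/g.
have near (u v : 'rV[int]_d) : u != v ->
    green R (u - v) <= g - 1 \/ green R (u - v) <= 31 / 125.
  move=> uv; have [a|na] := boolP (lattice_adj u v).
    by left; rewrite (green_adj d0 tr a).
  by right; exact: far.
have [Axy|/(far _ _ xy)] := boolP (lattice_adj x y); last first.
  by case: (near _ _ xz) (near _ _ yz) => h [] h'; lra.
have [Axz|/(far _ _ xz)] := boolP (lattice_adj x z); last first.
  by case: (near _ _ xy) (near _ _ yz) => h [] h'; lra.
have [Ayz|/(far _ _ yz)] := boolP (lattice_adj y z); last first.
  by case: (near _ _ xy) (near _ _ xz) => h [] h'; lra.
move: (lattice_adj_parity Axy) (lattice_adj_parity Axz) (lattice_adj_parity Ayz).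
by case: (parity x) (parity y) (parity z) => [] [] [].
Qed.

(** * Triples and quadruples in dimension three *)

Section DimensionThree.
Context (R : realType).
Local Notation pt := 'rV[int]_3.
Implicit Types x y z w : pt.

Let tr : exists h : pt -> R, supersolution h.
Proof. by exists (upper_sol R); exact: upper_sol_super. Qed.

Local Notation g := (green R (0 : pt)).

Let g_lower : 73 / 50 <= g. Proof. exact: green3_lower. Qed.

Let g_upper : g <= 153 / 100. Proof. by case: (green3_upper R 0). Qed.

Let green3_adj x y : lattice_adj x y -> green R (x - y) = g - 1.
Proof. exact: green_adj. Qed.

Let green3_far x y : x != y -> ~~ lattice_adj x y ->
  green R (x - y) <= 43 / 125.
Proof.
by move=> xy na; case: (green3_upper R (x - y)) => _ + _; apply; exact: nonadj_norm1.
Qed.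

Let green3_farther x y : x != y -> ~~ lattice_adj x y ->
  parity x (+) parity y -> green R (x - y) <= 34 / 125.
Proof.
by move=> xy na p; case: (green3_upper R (x - y)) => _ _; apply; exact: nonadj_norm1_odd.
Qed.

(** If one pair is adjacent, the third point is at odd distance, hence at least 3, from one of its
    members; the sum is then at most g(0) - 1 + 43/125 + 34/125, below 3 g(0)/4 as g(0) <= 1.53. If
    none is, 129/125 is below 3/4 of 1.46. *)
Lemma triple3_gt x y z : x != y -> x != z -> y != z ->
  (lattice_adj x y + lattice_adj x z + lattice_adj y z <= 1)%N ->
  2 / g < rcap R [:: x; y; z].
Proof.
have [gl gu] := (g_lower, g_upper).
move=> xy xz yz; apply: contraTT; rewrite -leNgt => cap.
have S : 3 / 4 * g <= green R (x - y) + green R (x - z) + green R (y - z).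
  by rewrite leNgt; apply: contraTN cap => h; rewrite -ltNge rcap3_gt.
move: S.
have sp (u v : pt) : lattice_adj u v -> forall t : pt,
    (parity t (+) parity u) || (parity t (+) parity v).
  by move=> /lattice_adj_parity + t; case: (parity u); case: (parity v); case: (parity t).
have [Axy|Nxy] := boolP (lattice_adj x y); have [Axz|Nxz] := boolP (lattice_adj x z);
  have [Ayz|Nyz] := boolP (lattice_adj y z) => //= S; exfalso; move: S.
- rewrite (green3_adj Axy); have := green3_far xz Nxz; have := green3_far yz Nyz.
  have /orP[p|p] := sp _ _ Axy z.
    by rewrite addbC in p; have := green3_farther xz Nxz p; lra.
  by rewrite addbC in p; have := green3_farther yz Nyz p; lra.
- rewrite (green3_adj Axz); have := green3_far xy Nxy; have := green3_far yz Nyz.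
  have /orP[p|p] := sp _ _ Axz y.
    by rewrite addbC in p; have := green3_farther xy Nxy p; lra.
  by have := green3_farther yz Nyz p; lra.
- rewrite (green3_adj Ayz); have := green3_far xy Nxy; have := green3_far xz Nxz.
  have /orP[p|p] := sp _ _ Ayz x.
    by have := green3_farther xy Nxy p; lra.
  by have := green3_farther xz Nxz p; lra.
- by have := green3_far xy Nxy; have := green3_far xz Nxz; have := green3_far yz Nyz; lra.
Qed.

(** The margin is small: (2 - g(0))^2 <= 0.54^2 = 0.2916, while g(0) g(u) >= 1.46 times 0.2 =
    0.292. *)
Lemma path3_le x y z : x != y -> x != z -> y != z ->
  (1 < lattice_adj x y + lattice_adj x z + lattice_adj y z)%N ->
  rcap R [:: x; y; z] <= 2 / g.
Proof.
have [gl gu] := (g_lower, g_upper).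
move=> xy xz yz adj; apply: rcap_path_le => //.
  by move: adj; case: (lattice_adj x y) (lattice_adj x z) (lattice_adj y z) => [] [] [].
move=> u /(green3_norm2_lower R); rewrite -/g; move: (green R u) => b b0.
have : 73 / 50 * (1 / 5) <= g * b by apply: ler_pM; lra.
have : (2 - g) ^+ 2 <= (2 - 73 / 50) ^+ 2.
  by rewrite lerXn2r ?nnegrE; lra.
lra.
Qed.

(* If no vertex is adjacent to all the others, every column of the Green matrix
   has sum at most g + 2 (g - 1) + 43/125 < 2 g. *)
Lemma quad3_gt w x y z : uniq [:: w; x; y; z] ->
  2 / g < rcap R [:: w; x; y; z].
Proof.
have [gl gu] := (g_lower, g_upper).
move=> u; have /and4P[] := u; rewrite !inE !negb_or => /and3P[wx wy wz] /andP[xy xz] yz _.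
(* Were a adjacent to b, c and e, these would be pairwise nonadjacent by parity, and by [triple3_gt]
   and monotonicity the capacity would exceed 2/g(0). So one of the three values is at most
   43/125. *)
have star a b c e : [&& a != b, a != c, a != e, b != c, b != e & c != e] ->
    {subset [:: b; c; e] <= [:: w; x; y; z]} ->
    rcap R [:: w; x; y; z] <= 2 / g ->
    green R (b - a) + green R (c - a) + green R (e - a) <= 2 * (g - 1) + 43 / 125.
  move=> /and5P[ab ac ae bc /andP[be ce]] sub cap.
  have far (v : pt) : a != v -> ~~ lattice_adj a v -> green R (v - a) <= 43 / 125.
    by rewrite greenC; exact: green3_far.
  have near (v : pt) : a != v -> green R (v - a) <= g - 1.
    move=> av; have [h|h] := boolP (lattice_adj a v); first by rewrite greenC green3_adj.
    by have := far _ av h; lra.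
  have := near _ ab; have := near _ ac; have := near _ ae.
  have [Ab|/(far _ ab)] := boolP (lattice_adj a b); last by lra.
  have [Ac|/(far _ ac)] := boolP (lattice_adj a c); last by lra.
  have [Ae|/(far _ ae)] := boolP (lattice_adj a e); last by lra.
  exfalso; move: cap; apply/negP; rewrite -ltNge.
  have ub : uniq [:: b; c; e] by rewrite /= !inE negb_or bc be ce.
  apply: lt_le_trans (rcap_le tr isT ub u sub).
  apply: triple3_gt => //.
  have nadj p q : lattice_adj a p -> lattice_adj a q -> lattice_adj p q = false.
    move=> /lattice_adj_parity Ap /lattice_adj_parity Aq; apply/negP => /lattice_adj_parity.
    by move: Ap Aq; case: (parity a) (parity p) (parity q) => [] [] [].
  by rewrite (nadj _ _ Ab Ac) (nadj _ _ Ab Ae) (nadj _ _ Ac Ae).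
rewrite ltNge; apply/negP => cap.
have [yx zx zy] : [/\ y != x, z != x & z != y] by split; rewrite eq_sym.
have [xw yw zw] : [/\ x != w, y != w & z != w] by split; rewrite eq_sym.
pose M := g + (2 * (g - 1) + 43 / 125).
have M0 : 0 < M by rewrite /M; lra.
have MG : M < 2 * g by rewrite /M; lra.
have : 4%:R / M <= rcap R [:: w; x; y; z].
  apply: (@rcap_column_gt R 3 isT tr [:: w; x; y; z] M u M0) => v.
  rewrite !inE !big_cons big_nil addr0 => /or4P[]/eqP->; rewrite subrr.
  - suff : green R (x - w) + green R (y - w) + green R (z - w) <=
      2 * (g - 1) + 43 / 125 by rewrite /M; lra.
    apply: star cap; first by rewrite wx wy wz xy xz yz.
    by move=> t; rewrite !inE => /or3P[]/eqP->; rewrite eqxx ?orbT.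
  - suff : green R (w - x) + green R (y - x) + green R (z - x) <=
      2 * (g - 1) + 43 / 125 by rewrite /M; lra.
    apply: star cap; first by rewrite xw xy xz wy wz yz.
    by move=> t; rewrite !inE => /or3P[]/eqP->; rewrite eqxx ?orbT.
  - suff : green R (w - y) + green R (x - y) + green R (z - y) <=
      2 * (g - 1) + 43 / 125 by rewrite /M; lra.
    apply: star cap; first by rewrite yw yx yz wx wz xz.
    by move=> t; rewrite !inE => /or3P[]/eqP->; rewrite eqxx ?orbT.
  - suff : green R (w - z) + green R (x - z) + green R (y - z) <=
      2 * (g - 1) + 43 / 125 by rewrite /M; lra.
    apply: star cap; first by rewrite zw zx zy wx wy xy.
    by move=> t; rewrite !inE => /or3P[]/eqP->; rewrite eqxx ?orbT.
rewrite leNgt => /negP; apply; apply: le_lt_trans cap _.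
have g0 : 0 < g by lra.
by rewrite ltr_pdivlMr// mulrAC ltr_pdivrMr//; lra.
Qed.

End DimensionThree.

(** * Connectedness of three-point sets *)

Lemma connected_neighbor d (K : {fset 'rV[int]_d}) x y :
  lattice_connected K -> x \in K -> y \in K -> x != y ->
  exists2 v, v \in K & lattice_adj x v.
Proof.
move=> cK xK yK xy; have [[|v p] [/= pp pK lp]] := cK _ _ xK yK.
  by rewrite lp eqxx in xy.
by exists v; [apply: pK; rewrite mem_head|case/andP: pp].
Qed.

Lemma star_connected d (K : {fset 'rV[int]_d}) c : c \in K ->
  (forall u, u \in K -> u != c -> lattice_adj c u) -> lattice_connected K.
Proof.
move=> cK star u v uK vK; have [<-|uv] := eqVneq u v; first by exists [::].
have [uc|uc] := eqVneq u c.
  exists [:: v]; split=> //=; last by move=> t; rewrite inE => /eqP->.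
  by rewrite andbT uc star// eq_sym -uc.
have [vc|vc] := eqVneq v c.
  exists [:: v]; split=> //=; last by move=> t; rewrite inE => /eqP->.
  by rewrite andbT vc lattice_adjC star.
exists [:: c; v]; split=> //=; last by move=> t; rewrite !inE => /orP[]/eqP->.
by rewrite andbT lattice_adjC !star.
Qed.

(** In a connected set each of the three points has a neighbour, which forces two adjacent pairs.
    Conversely, two pairs share a point, and K is a star around it. *)
Lemma connected3P d (K : {fset 'rV[int]_d}) x y z : K =i [:: x; y; z] ->
  uniq [:: x; y; z] ->
  lattice_connected K <->
  (1 < lattice_adj x y + lattice_adj x z + lattice_adj y z)%N.
Proof.
move=> KE /and3P[]; rewrite !inE negb_or => /andP[xy xz] yz _.
have [xK yK zK] : [/\ x \in K, y \in K & z \in K].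
  by rewrite !KE !inE !eqxx !orbT.
split=> [cK|].
  have nx : lattice_adj x y || lattice_adj x z.
    have [v] := connected_neighbor cK xK yK xy.
    by rewrite KE !inE => /or3P[]/eqP->; rewrite ?lattice_adjxx// => ->; rewrite ?orbT.
  have ny : lattice_adj x y || lattice_adj y z.
    have [v] := connected_neighbor cK yK zK yz.
    rewrite KE !inE (lattice_adjC x y) => /or3P[]/eqP->; rewrite ?lattice_adjxx// => ->;
      by rewrite ?orbT.
  have nz : lattice_adj x z || lattice_adj y z.
    have [|v] := @connected_neighbor _ _ z x cK zK xK; first by rewrite eq_sym.
    rewrite KE !inE (lattice_adjC x z) (lattice_adjC y z) => /or3P[]/eqP->;
      rewrite ?lattice_adjxx// => ->; by rewrite ?orbT.
  by move: nx ny nz; move: (lattice_adj x y) (lattice_adj x z) (lattice_adj y z) => [] [] [].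
have [Axy|_] := boolP (lattice_adj x y); have [Axz|_] := boolP (lattice_adj x z);
  have [Ayz|_] := boolP (lattice_adj y z) => // _.
1,2: apply: (star_connected xK) => u; rewrite KE !inE => /or3P[]/eqP->//; by rewrite eqxx.
- apply: (star_connected yK) => u; rewrite KE !inE => /or3P[]/eqP->//; last by rewrite eqxx.
  by rewrite lattice_adjC.
- apply: (star_connected zK) => u; rewrite KE !inE => /or3P[]/eqP->//; rewrite ?eqxx//.
  by rewrite lattice_adjC.
  by rewrite lattice_adjC.
Qed.

Lemma rcap_small_le (R : realType) d (s : seq 'rV[int]_d) : (0 < d)%N ->
  (exists h : 'rV[int]_d -> R, supersolution h) -> uniq s ->
  (1 <= size s <= 2)%N -> rcap R s <= 2 / green R (0 : 'rV[int]_d).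
Proof.
move=> d0 tr; case: s => [|x [|y [|]]]//= us _; first exact: rcap1_le.
by apply: rcap2_le => //; move: us; rewrite inE andbT.
Qed.

(** * Classification of the sets of small capacity *)

Theorem theoremB1 (R : realType) (d : nat)
    (disp : measure_display) (Omega : measurableType disp)
    (P : 'rV[int]_d -> probability Omega R)
    (X : nat -> Omega -> 'rV[int]_d)
    (hd : (3 <= d)%N) (hX : simple_random_walk P X) :
  ((4 <= d)%N ->
     small_capacity_sets P X =
     [set K : {fset 'rV[int]_d} | (1 <= #|` K| <= 2)%N]) /\
  (d = 3%N ->
     small_capacity_sets P X =
     [set K : {fset 'rV[int]_d} | (1 <= #|` K| <= 2)%N \/
                                  (#|` K| = 3%N /\ lattice_connected K)]).
Proof.
have d0 : (0 < d)%N by exact: leq_trans hd.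
split=> [d4|d3].
  have tr : exists h : 'rV[int]_d -> R, supersolution h.
    by eexists; exact: (tau4_super R d4).
  apply/funext => K; rewrite (small_capacity_setsE d0 hX tr) /=.
  rewrite -cardfs_gt0; have us := fset_uniq K.
  apply/propext; split=> [[-> /= cap]|/[dup] K12 /andP[K1 _]]; last first.
    by split=> //; exact: rcap_small_le.
  case: (enum_fset K) us cap => [|x [|y [|z s]]]// us cap; exfalso.
  move: cap; apply/negP; rewrite -ltNge.
  (* By monotonicity of capacity, three of the points already give the contradiction. *)
  have [u3 sub] : uniq [:: x; y; z] /\ {subset [:: x; y; z] <= [:: x, y, z & s]}.
    split; first by apply: subseq_uniq us; exact: (prefix_subseq [:: x; y; z]).
    by move=> t; rewrite !inE => /or3P[]->; rewrite ?orbT.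
  apply: lt_le_trans (rcap_le tr d0 u3 us sub).
  case/and3P: u3; rewrite !inE negb_or => /andP[xy xz] yz _.
  exact: high_triple_gt.
subst d; have tr : exists h : 'rV[int]_3 -> R, supersolution h.
  by eexists; exact: upper_sol_super.
apply/funext => K; rewrite (small_capacity_setsE d0 hX tr) /=.
rewrite -cardfs_gt0; have us := fset_uniq K.
have KE : K =i enum_fset K by [].
apply/propext; split=> [[K1 cap]|[/[dup] K12 /andP[K1 _]|[K3 cK]]].
- case: (enum_fset K) us cap KE K1 => [|x [|y [|z [|w s]]]]// us cap KE _;
    [by left|by left|right|exfalso].
    split=> //; apply/(connected3P KE us); rewrite ltnNge; apply/negP => adj.
    move: cap; apply/negP; rewrite -ltNge.
    case/and3P: us; rewrite !inE negb_or => /andP[xy xz] yz _.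
    exact: triple3_gt.
  move: cap; apply/negP; rewrite -ltNge.
  have [u4 sub] : uniq [:: x; y; z; w] /\ {subset [:: x; y; z; w] <= [:: x, y, z, w & s]}.
    split; first by apply: subseq_uniq us; exact: (prefix_subseq [:: x; y; z; w]).
    by move=> t; rewrite !inE => /or4P[]->; rewrite ?orbT.
  by apply: lt_le_trans (rcap_le tr d0 u4 us sub); exact: quad3_gt.
- by split=> //; exact: rcap_small_le.
- split; first by rewrite K3.
  case: (enum_fset K) us KE K3 => [|x [|y [|z [|w s]]]]// us KE _.
  have /(connected3P KE us) adj := cK.
  case/and3P: us; rewrite !inE negb_or => /andP[xy xz] yz _.
  exact: path3_le.
Qed.
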